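(* An extremely amenable topological group admitting a faithful uniformly continuous unitary representation does not have property $(T)$ (that is, is not a Kazhdan group).
   Context: All topological groups are Hausdorff. A topological group $G$ is extremely amenable if every continuous action of $G$ on a (non-empty) compact Hausdorff space has a fixed point. A uniformly continuous unitary representation of $G$ is a homomorphism $G\to U(\mathcal H)$, $\mathcal H$ a Hilbert space, that is continuous with respect to the uniform operator (operator norm) topology on $U(\mathcal H)$; faithful means injective. A strongly continuous unitary representation $\pi$ of $G$ has almost invariant vectors if for every $\varepsilon>0$ and every compact $K\subseteq G$ there is a unit vector $\xi$ with $\|\xi-\pi_g\xi\|<\varepsilon$ for all $g\in K$. $G$ has property $(T)$ (is a Kazhdan group) if every strongly continuous unitary representation of $G$ having almost invariant vectors has an invariant unit vector.
   Formalization: The group is assumed to be nontrivial; the claim fails for the trivial group, which is extremely amenable, has a faithful uniformly continuous unitary representation and has property (T). *)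

(* Defs.v *)
From HB Require Import structures.
From mathcomp Require Import all_boot all_order all_algebra.
From mathcomp Require Import complex.
From mathcomp Require Import boolp classical_sets functions reals topology.
From mathcomp Require Import normedtype.

Set Implicit Arguments.
Unset Strict Implicit.
Unset Printing Implicit Defensive.

Import Order.TTheory GRing.Theory Num.Theory.
Import numFieldNormedType.Exports.

Local Open Scope classical_set_scope.
Local Open Scope ring_scope.
Local Open Scope complex_scope.

HB.mixin Record isTopologicalGroup G & Topological G & Group G := {
  mulg_continuous : continuous (fun p : G * G => (p.1 * p.2)%g);
  invg_continuous : continuous (fun g : G => (g^-1)%g)
}.

#[short(type="topologicalGroupType")]
HB.structure Definition TopologicalGroup :=
  {G of Topological G & Group G & isTopologicalGroup G}.

(* Complex Hilbert spaces. The norm of a normed module over R[i] takes its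
   values in R[i]; [inner] is linear in its first argument and conjugate-linear
   in its second one. The zero space is allowed. *)
HB.mixin Record isHilbert (R : realType) H & CompleteNormedModule R[i] H := {
  inner : {dot H for (@Num.conj R[i])};
  inner_norm : forall x : H, inner x x = `|x| ^+ 2
}.

#[short(type="hilbertType")]
HB.structure Definition Hilbert (R : realType) :=
  {H of CompleteNormedModule R[i] H & isHilbert R H}.

Definition continuous_action (G : topologicalGroupType) (X : topologicalType)
    (act : G -> X -> X) : Prop :=
  [/\ forall x, act 1%g x = x,
      forall g h x, act (g * h)%g x = act g (act h x)
    & continuous (fun p : G * X => act p.1 p.2)].

Definition extremely_amenable (G : topologicalGroupType) : Prop :=
  forall X : topologicalType,
    compact [set: X] -> hausdorff_space X -> [set: X] !=set0 ->
    forall act : G -> X -> X, continuous_action act ->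
      exists x : X, forall g : G, act g x = x.

Section UnitaryRepresentations.
Context {R : realType}.

Definition unitary_op (H : hilbertType R) (u : H -> H) : Prop :=
  [/\ linear u, bijective u & forall x y, inner (u x) (u y) = inner x y].

(* The supremum of the norms over the closed unit ball; meaningful for bounded
   operators only, as [sup] is 0 on sets without upper bound. *)
Definition op_norm (H : hilbertType R) (f : H -> H) : R :=
  sup [set complex.Re `|f x| | x in [set x : H | `|x| <= 1]].

Context {G : topologicalGroupType} {H : hilbertType R}.

(* A homomorphism to U(H); that pi 1 is the identity follows, as pi 1 is an
   idempotent bijection. *)
Definition unitary_rep (pi : G -> H -> H) : Prop :=
  (forall g, unitary_op (pi g)) /\ (forall g h, pi (g * h)%g = pi g \o pi h).

Definition uniformly_continuous_rep (pi : G -> H -> H) : Prop :=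
  unitary_rep pi /\
  forall g0 : G, op_norm (fun x => pi g x - pi g0 x) @[g --> g0] --> (0 : R).

Definition strongly_continuous_rep (pi : G -> H -> H) : Prop :=
  unitary_rep pi /\ forall x : H, continuous (fun g => pi g x).

Definition almost_invariant_vectors (pi : G -> H -> H) : Prop :=
  forall (eps : R) (K : set G), 0 < eps -> compact K ->
    exists2 xi : H, `|xi| = 1 & forall g, K g -> `|xi - pi g xi| < eps%:C.

Definition invariant_unit_vector (pi : G -> H -> H) : Prop :=
  exists2 xi : H, `|xi| = 1 & forall g, pi g xi = xi.

End UnitaryRepresentations.

Definition property_T (R : realType) (G : topologicalGroupType) : Prop :=
  forall (H : hilbertType R) (pi : G -> H -> H),
    strongly_continuous_rep pi -> almost_invariant_vectors pi ->
    invariant_unit_vector pi.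

(* Main.v *)
(* Let pi be a faithful uniformly continuous unitary representation of G, let
   HS be the space of Hilbert-Schmidt operators on the closed span of the
   vectors pi(g)y - y, and let G act on HS by conjugation. Extreme amenability
   excludes nonzero invariant vectors in HS: an invariant operator is a norm
   limit of finite rank operators, whereas for finitely many y_i in the span
   and any y some translate pi(g)y is almost orthogonal to all the y_i. If G
   had property (T), the action on HS would therefore have a spectral gap: for a
   finite symmetric set L the average M over L has norm < rho < 1 on HS.

   Fix a unit vector e in the span. For a finite subset E of G let q be the
   quadratic form of the Green operator sum_m rho^-m M^m (sum_{x in E} P_x),
   P_x being the projection onto the line of pi(x)e. Its average over L is at
   most rho q. Morally log q has bounded increments log q(g.) - log q, whose
   average over L is at most log rho < 0, while the increments for g and g^-1
   cancel up to a translation by g, which a point almost fixed by L cannot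
   tolerate. The logarithm of an operator is replaced by the sum over j of the
   Moreau envelopes inf_y (rho^j q(y) + |x - y|^2), which are quadratic forms
   again, so that the increments, being bounded quadratic forms, are Lipschitz
   on the sphere uniformly in E. Passing to a limit along an ultrafilter over E
   makes the drift negative along the whole orbit of e. *)

Require Import Defs.
From HB Require Import structures.
From mathcomp Require Import all_boot all_order all_algebra.
From mathcomp Require Import complex ring lra.
From mathcomp Require Import mathcomp_extra boolp classical_sets functions reals topology.
From mathcomp Require Import normedtype sequences.

Set Implicit Arguments.
Unset Strict Implicit.
Unset Printing Implicit Defensive.

Import Order.TTheory GRing.Theory Num.Theory.
Import numFieldNormedType.Exports.

Local Open Scope classical_set_scope.
Local Open Scope ring_scope.

(** * Reproducing kernel Hilbert spaces *)

(* A formal combination [sum_i c_i z_i] is the list of the [(c_i, z_i)]. *)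
Section FormalCombinations.
Context {R : realType} {Z : Type}.
Implicit Types (f g : Z -> R) (s t : seq (R * Z)) (a : R).

Definition ev f t : R := \sum_(p <- t) p.1 * f p.2.

Definition scalet a t : seq (R * Z) := [seq (a * p.1, p.2) | p <- t].

Lemma ev_nil f : ev f [::] = 0.
Proof. by rewrite /ev big_nil. Qed.

Lemma ev_cons f p t : ev f (p :: t) = p.1 * f p.2 + ev f t.
Proof. by rewrite /ev big_cons. Qed.

Lemma ev_cat f s t : ev f (s ++ t) = ev f s + ev f t.
Proof. by rewrite /ev big_cat. Qed.

Lemma ev_scalet f a t : ev f (scalet a t) = a * ev f t.
Proof.
by rewrite /ev big_map mulr_sumr; apply: eq_bigr => p _ /=; rewrite mulrA.
Qed.

Lemma evD f g t : ev (f + g) t = ev f t + ev g t.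
Proof.
by rewrite /ev -big_split; apply: eq_bigr => p _; rewrite /= mulrDr.
Qed.

Lemma evZ a f t : ev (a *: f) t = a * ev f t.
Proof.
rewrite /ev mulr_sumr; apply: eq_bigr => p _.
by rewrite /GRing.scale/= mulrCA.
Qed.

Lemma evN f t : ev (- f) t = - ev f t.
Proof. by rewrite -scaleN1r evZ mulN1r. Qed.

Lemma evB f g t : ev (f - g) t = ev f t - ev g t.
Proof. by rewrite evD evN. Qed.

Lemma eq_ev f g t : f =1 g -> ev f t = ev g t.
Proof. by move=> fg; apply: eq_bigr => p _; rewrite fg. Qed.

Definition gram (K : Z -> Z -> R) s t : R := ev (fun z => ev (K z) t) s.

End FormalCombinations.

(** By the inequality of arithmetic and geometric means [2 u v] is at most [a q + b p]; comparing
    squares avoids square roots. It serves to add two Cauchy-Schwarz estimates. *)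
Lemma sqrD_le_mul {R : realFieldType} (u v a b p q : R) :
  0 <= a -> 0 <= b -> 0 <= p -> 0 <= q -> u ^+ 2 <= a * p -> v ^+ 2 <= b * q ->
  (u + v) ^+ 2 <= (a + b) * (p + q).
Proof.
move=> a0 b0 p0 q0 up vq.
have uv : (2 * u * v) ^+ 2 <= (a * q + b * p) ^+ 2.
  have h : u ^+ 2 * v ^+ 2 <= (a * p) * (b * q) by rewrite ler_pM ?sqr_ge0.
  by have := sqr_ge0 (a * q - b * p); nra.
have aq : 0 <= a * q + b * p by rewrite addr_ge0 ?mulr_ge0.
have : 2 * u * v <= a * q + b * p.
  rewrite leNgt; apply/negP => lt; move: uv; apply/negP; rewrite -ltNge.
  by rewrite ltrXn2r.
nra.
Qed.

(** * The real reproducing kernel Hilbert space of a positive semidefinite kernel *)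

Section Kernel.
Context {R : realType} {Z : Type}.

Record kernel := Kernel {
  kernel_fun :> Z -> Z -> R;
  kernelC : forall z w, kernel_fun z w = kernel_fun w z;
  gram_ge0 : forall t, 0 <= gram kernel_fun t t }.

Variable K : kernel.
Implicit Types (f g : Z -> R) (s t u : seq (R * Z)) (a : R).

Local Notation gm := (gram K).

Lemma gramC s t : (gm s t) = (gm t s).
Proof.
rewrite /gram /ev; under eq_bigr do rewrite mulr_sumr.
rewrite exchange_big/=; apply: eq_bigr => p _; rewrite mulr_sumr.
by apply: eq_bigr => q _; rewrite kernelC mulrCA.
Qed.

Lemma gramDl s t u : (gm (s ++ t) u) = (gm s u) + (gm t u).
Proof. by rewrite /gram ev_cat. Qed.

Lemma gramDr s t u : (gm u (s ++ t)) = (gm u s) + (gm u t).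
Proof. by rewrite gramC gramDl ![gram _ _ u]gramC. Qed.

Lemma gramZl a s t : (gm (scalet a s) t) = a * (gm s t).
Proof. by rewrite /gram ev_scalet. Qed.

Lemma gramZr a s t : (gm s (scalet a t)) = a * (gm s t).
Proof. by rewrite gramC gramZl gramC. Qed.

Lemma gram1 z w : gm [:: (1, z)] [:: (1, w)] = K z w.
Proof. by rewrite /gram /ev !big_seq1 /= !mul1r. Qed.

Definition gramE := (gramDl, gramDr, gramZl, gramZr).

Lemma gram_cauchy_schwarz s t : (gm s t) ^+ 2 <= (gm s s) * (gm t t).
Proof.
have H a b : 0 <= a ^+ 2 * (gm s s) + 2 * a * b * (gm s t) + b ^+ 2 * (gm t t).
  have := gram_ge0 K (scalet a s ++ scalet b t).
  by rewrite !gramE (gramC t s); congr (0 <= _); ring.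
have s0 := gram_ge0 K s; have t0 := gram_ge0 K t.
have [t00|tN0] := eqVneq (gm t t) 0; last first.
  have tp : 0 < (gm t t) by rewrite lt_def tN0.
  have := H (gm t t) (- (gm s t)).
  rewrite (_ : _ + _ = (gm t t) * ((gm s s) * (gm t t) - (gm s t) ^+ 2)); last ring.
  by rewrite pmulr_rge0// subr_ge0.
(* For a null [t] this choice turns [H] into [- (gm s s + 2) (gm s t)^2 >= 0], so that [gm s t]
   vanishes. *)
have := H (- (gm s t)) ((gm s s) + 1); rewrite t00 !mulr0 addr0.
rewrite (_ : _ + _ = - (((gm s s) + 2) * (gm s t) ^+ 2)); last by ring.
by have := sqr_ge0 (gm s t); nra.
Qed.

(** Such an [f] is a bounded functional on the formal combinations with the seminorm of [gram], and
    [rknorm2] is the square of its dual norm. As functions on [Z] these functionals form the Hilbert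
    space of [K], without a quotient or a completion. *)
Definition rkbounded f := exists M, forall t, ev f t ^+ 2 <= M * (gm t t).

Definition rknorm2 f : R :=
  sup [set ev f t ^+ 2 | t in [set t | (gm t t) <= 1]].

Lemma rknorm2_has_sup f : rkbounded f ->
  has_sup [set ev f t ^+ 2 | t in [set t | (gm t t) <= 1]].
Proof.
move=> [M fM]; split.
  by exists (ev f [::] ^+ 2), [::] => //=; rewrite /gram ev_nil.
exists `|M| => _ [t /= t1 <-]; apply: (le_trans (fM t)).
rewrite (le_trans (ler_norm _))// normrM ler_piMr//.
by rewrite ger0_norm ?gram_ge0.
Qed.

Lemma rknorm2_ge0 f : rkbounded f -> 0 <= rknorm2 f.
Proof.
move=> /rknorm2_has_sup fb.
apply: (le_trans (sqr_ge0 (ev f [::]))); apply: sup_upper_bound => //.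
by exists [::] => //=; rewrite /gram ev_nil.
Qed.

Lemma ev_le_rknorm2 f t : rkbounded f -> ev f t ^+ 2 <= rknorm2 f * (gm t t).
Proof.
move=> fb; have [M fM] := fb.
have [t0|tN0] := eqVneq (gm t t) 0.
  by rewrite t0 mulr0; move: (fM t); rewrite t0 mulr0.
have tp : 0 < (gm t t) by rewrite lt_def tN0 gram_ge0.
rewrite -ler_pdivrMr//.
apply: sup_upper_bound; first exact: rknorm2_has_sup.
exists (scalet (Num.sqrt (gm t t))^-1 t) => /=.
  by rewrite !gramE mulrA -invfM -expr2 sqr_sqrtr ?mulVf// ltW.
by rewrite ev_scalet exprMn exprVn sqr_sqrtr ?(ltW tp)// mulrC.
Qed.

Lemma rknorm2_le f M : (forall t, ev f t ^+ 2 <= M * (gm t t)) -> 0 <= M ->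
  rknorm2 f <= M.
Proof.
move=> fM M0; apply: ge_sup => [|_ [t /= t1 <-]].
  by exists (ev f [::] ^+ 2), [::] => //=; rewrite /gram ev_nil.
by rewrite (le_trans (fM t))// ler_piMr.
Qed.

Lemma rknorm2_lub f M : rkbounded f ->
  (forall t, (gm t t) <= 1 -> ev f t ^+ 2 <= M) -> rknorm2 f <= M.
Proof.
move=> fb fM; apply: ge_sup => [|_ [t /= t1 <-]]; last exact: fM.
by exists (ev f [::] ^+ 2), [::] => //=; rewrite /gram ev_nil.
Qed.

Lemma rknorm2_adherent f eps : rkbounded f -> 0 < eps ->
  exists2 t, (gm t t) <= 1 & rknorm2 f - eps < ev f t ^+ 2.
Proof.
move=> /rknorm2_has_sup fb e0.
by have [_ [t /= t1 <-] lt] := sup_adherent e0 fb; exists t.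
Qed.

Lemma rkbounded0 : rkbounded 0.
Proof.
exists 0 => t; rewrite mul0r (_ : ev 0 t = 0) ?expr0n//.
by rewrite /ev big1// => p _; rewrite mulr0.
Qed.

Lemma rkboundedZ a f : rkbounded f -> rkbounded (a *: f).
Proof.
move=> [M fM]; exists (a ^+ 2 * M) => t.
by rewrite evZ exprMn -mulrA ler_wpM2l// sqr_ge0.
Qed.

Lemma rkboundedD f g : rkbounded f -> rkbounded g -> rkbounded (f + g).
Proof.
move=> [M fM] [N gN]; exists (2 * M + 2 * N) => t.
rewrite evD; have := fM t; have := gN t; have := sqr_ge0 (ev f t - ev g t).
nra.
Qed.

Lemma rkboundedN f : rkbounded f -> rkbounded (- f).
Proof. by move=> fb; rewrite -scaleN1r; exact: rkboundedZ. Qed.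

Lemma rkboundedB f g : rkbounded f -> rkbounded g -> rkbounded (f - g).
Proof. by move=> fb gb; apply: rkboundedD => //; exact: rkboundedN. Qed.

Lemma rknorm2Z a f : rkbounded f -> rknorm2 (a *: f) = a ^+ 2 * rknorm2 f.
Proof.
have le b g : rkbounded g -> rknorm2 (b *: g) <= b ^+ 2 * rknorm2 g.
  move=> gb; apply: rknorm2_le => [t|]; last by rewrite mulr_ge0 ?sqr_ge0 ?rknorm2_ge0.
  rewrite evZ exprMn -(mulrA (b ^+ 2) _ (gm t t)).
 by rewrite ler_wpM2l ?sqr_ge0 ?ev_le_rknorm2.
move=> fb; apply/eqP; rewrite eq_le le//=.
have [->|a0] := eqVneq a 0.
  by rewrite expr0n/= mul0r rknorm2_ge0//; apply: rkboundedZ.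
have /(le a^-1) := rkboundedZ a fb.
rewrite scalerA mulVf// scale1r exprVn ler_pdivlMl//.
by rewrite exprn_even_gt0//= a0 orbT.
Qed.

Lemma rknorm2N f : rkbounded f -> rknorm2 (- f) = rknorm2 f.
Proof. by move=> fb; rewrite -scaleN1r rknorm2Z// sqrrN expr1n mul1r. Qed.

(** The law passes from [gram] to the dual norm. For one inequality, combinations [t] and [s]
    testing [u + v] and [u - v] are recombined into [t + s], which tests [u], and [t - s], which
    tests [v]. The other inequality is the first one for [f + g] and [f - g]. *)
Lemma rknorm2_parallelogram f g : rkbounded f -> rkbounded g ->
  rknorm2 (f + g) + rknorm2 (f - g) = 2 * rknorm2 f + 2 * rknorm2 g.
Proof.
have le (u v : Z -> R) : rkbounded u -> rkbounded v ->
    rknorm2 (u + v) + rknorm2 (u - v) <= 2 * rknorm2 u + 2 * rknorm2 v.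
  move=> ub vb; rewrite -lerBrDr; apply: rknorm2_lub => [|t t1].
    exact: rkboundedD.
  rewrite lerBrDr -lerBrDl; apply: rknorm2_lub => [|s s1].
    exact: rkboundedB.
  rewrite lerBrDl.
  (* After rescaling, the value of the functional is a square [a^2] that also bounds the form at the
     combination. Cauchy-Schwarz then yields [(a^2 + b^2)^2 <= 2 (|u|^2 + |v|^2) (a^2 + b^2)], where
     one factor cancels. *)
  have scaled w r : gm r r <= 1 ->
      exists2 r', ev w r' = ev w r ^+ 2 & gm r' r' <= ev w r ^+ 2.
    move=> r1; exists (scalet (ev w r) r); first by rewrite ev_scalet expr2.
    by rewrite !gramE mulrA -expr2 ler_piMr ?sqr_ge0.
  have [t' at' t'a] := scaled (u + v) t t1.
  have [s' bs' s'b] := scaled (u - v) s s1.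
  move: at' t'a bs' s'b.
  move: (ev (u + v) t) (ev (u - v) s) => a b at' t'a bs' s'b.
  have e1 := ev_le_rknorm2 (t' ++ s') ub.
  have e2 := ev_le_rknorm2 (t' ++ scalet (-1) s') vb.
  have hp := gram_ge0 K (t' ++ s').
  have hm := gram_ge0 K (t' ++ scalet (-1) s').
  have nu := rknorm2_ge0 ub; have nv := rknorm2_ge0 vb.
  have pm : gm (t' ++ s') (t' ++ s') +
      gm (t' ++ scalet (-1) s') (t' ++ scalet (-1) s') = 2 * gm t' t' + 2 * gm s' s'.
    by rewrite !gramE (gramC s' t'); ring.
  have ab : a ^+ 2 + b ^+ 2 = ev u (t' ++ s') + ev v (t' ++ scalet (-1) s').
    rewrite -at' -bs' evD evB !ev_cat ev_scalet; ring.
  have C0 : 0 <= a ^+ 2 + b ^+ 2 by rewrite addr_ge0 ?sqr_ge0.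
  have [->|abN0] := eqVneq (a ^+ 2 + b ^+ 2) 0; first lra.
  have abp : 0 < a ^+ 2 + b ^+ 2 by rewrite lt_def abN0.
  rewrite -(ler_pM2r abp).
  have : (a ^+ 2 + b ^+ 2) ^+ 2 <= (rknorm2 u + rknorm2 v) *
      (gm (t' ++ s') (t' ++ s') +
       gm (t' ++ scalet (-1) s') (t' ++ scalet (-1) s')).
    by rewrite ab; exact: sqrD_le_mul.
  rewrite pm; nra.
move=> fb gb; apply/eqP; rewrite eq_le le//=.
have /(le (f + g)) := rkboundedB fb gb; move=> /(_ (rkboundedD fb gb)).
have -> : f + g + (f - g) = 2 *: f.
  by rewrite addrACA subrr addr0 scaler_nat mulr2n.
have -> : f + g - (f - g) = 2 *: g.
  by rewrite opprB addrC addrA subrK scaler_nat mulr2n.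
rewrite !rknorm2Z//; lra.
Qed.

Definition rkdot f g : R := (rknorm2 (f + g) - rknorm2 (f - g)) / 4.
Arguments rkdot : simpl never.

Lemma rkdotff f : rkbounded f -> rkdot f f = rknorm2 f.
Proof.
move=> fb; rewrite /rkdot subrr -mulr2n -scaler_nat rknorm2Z//.
by rewrite -(scale0r f) rknorm2Z//; field.
Qed.

Lemma rkdotC f g : rkbounded f -> rkbounded g -> rkdot f g = rkdot g f.
Proof.
move=> fb gb; rewrite /rkdot (addrC f g) -(opprB g f) rknorm2N//.
exact: rkboundedB.
Qed.

Lemma rkdotNl f g : rkbounded f -> rkbounded g -> rkdot (- f) g = - rkdot f g.
Proof.
move=> fb gb; rewrite /rkdot -opprD rknorm2N; last exact: rkboundedD.
by rewrite (addrC (- f)) -(rknorm2N (rkboundedB fb gb)) opprB; lra.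
Qed.

(** As in the Jordan-von Neumann theorem: [half] is a difference of two parallelogram laws, and its
    instances for [(f, g)] and [(g, f)] add up to the claim. *)
Lemma rkdotDl f g (u : Z -> R) : rkbounded f -> rkbounded g -> rkbounded u ->
  rkdot (f + g) u = rkdot f u + rkdot g u.
Proof.
have half (f' g' v : Z -> R) : rkbounded f' -> rkbounded g' -> rkbounded v ->
    rkdot (f' + g') v + rkdot (f' - g') v = 2 * rkdot f' v.
  move=> fb gb vb; rewrite /rkdot.
  have := rknorm2_parallelogram (rkboundedD fb vb) gb.
  have := rknorm2_parallelogram (rkboundedB fb vb) gb.
  rewrite ![f' + _ + g']addrAC ![f' + _ - g']addrAC; lra.
move=> fb gb ub.
have h1 := half f g u fb gb ub; have h2 := half g f u gb fb ub.
have := rkdotNl (rkboundedB fb gb) ub; rewrite opprB => h3.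
move: h2; rewrite (addrC g f) h3; lra.
Qed.

Lemma rkdot_bound f g : rkbounded f -> rkbounded g ->
  `|rkdot f g| <= rknorm2 f + rknorm2 g.
Proof.
move=> fb gb; have := rknorm2_parallelogram fb gb.
have := rknorm2_ge0 (rkboundedD fb gb); have := rknorm2_ge0 (rkboundedB fb gb).
by rewrite /rkdot ler_norml => *; apply/andP; split; lra.
Qed.

(* An additive function of [a] vanishing at 1 and bounded on [0, 1] is zero. *)
Lemma rkdotZl a f g : rkbounded f -> rkbounded g ->
  rkdot (a *: f) g = a * rkdot f g.
Proof.
move=> fb gb.
pose phi b := rkdot (b *: f) g - b * rkdot f g.
have phiD b c : phi (b + c) = phi b + phi c.
  rewrite /phi scalerDl rkdotDl//; first ring.
  - exact: rkboundedZ.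
  - exact: rkboundedZ.
have phi1 : phi 1 = 0 by rewrite /phi scale1r mul1r subrr.
have phi0 : phi 0 = 0 by have := phiD 0 0; rewrite addr0; lra.
have phiN b : phi (- b) = - phi b by have := phiD b (- b); rewrite subrr; lra.
have phiMn b n : phi (b *+ n) = phi b *+ n.
  by elim: n => [|n IH]; rewrite ?mulr0n// !mulrS phiD IH.
have phiMz b (n : int) : phi (b *~ n) = phi b *~ n.
  by case: n => n; rewrite ?NegzE ?mulrNz ?phiN -?pmulrn phiMn.
pose C := 2 * rknorm2 f + 2 * rknorm2 g + 2.
have f0 := rknorm2_ge0 fb; have g0 := rknorm2_ge0 gb.
have phi01 b : 0 <= b <= 1 -> `|phi b| <= C.
  move=> /andP[b0 b1]; rewrite /phi.
  have h1 := rkdot_bound (rkboundedZ b fb) gb; rewrite rknorm2Z// in h1.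
  have h2 := rkdot_bound fb gb.
  have : b ^+ 2 * rknorm2 f <= rknorm2 f by rewrite ler_piMl// expr_le1.
  have : `|b * rkdot f g| <= `|rkdot f g|.
    by rewrite normrM ger0_norm// ler_piMl.
  have := ler_normB (rkdot (b *: f) g) (b * rkdot f g).
  rewrite /C; lra.
have phib b : `|phi b| <= C.
  rewrite -[b](subrK (Num.floor b)%:~R) phiD phiMz phi1 mul0rz addr0.
  apply: phi01; have /andP[h1 h2] := Num.Theory.real_floor_itv (num_real b).
  by rewrite subr_ge0 h1/=; rewrite intrD in h2; lra.
suff : phi a = 0 by rewrite /phi => /eqP; rewrite subr_eq0 => /eqP.
apply/eqP; rewrite -normr_eq0; apply/eqP/le_anti; rewrite normr_ge0 andbT.
rewrite leNgt; apply/negP => a0.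
have [n Cn] : exists n : nat, C / `|phi a| < n%:R.
  exists (Num.truncn (C / `|phi a|)).+1.
  exact: Num.Theory.truncnS_gt.
have := phib (a *+ n); rewrite phiMn normrMn leNgt => /negP; apply.
by rewrite -mulr_natl -ltr_pdivrMr.
Qed.

End Kernel.

(** * The complex Hilbert space and its completeness *)

Section Complexification.
Context {R : realType} {Z : Type} (K : @kernel R Z).
Implicit Types u v : Z -> R.

Lemma rknorm2D u v : rkbounded K u -> rkbounded K v ->
  rknorm2 K (u + v) = rknorm2 K u + 2 * rkdot K u v + rknorm2 K v.
Proof.
move=> ub vb; have := rknorm2_parallelogram ub vb.
by rewrite /rkdot; lra.
Qed.

Lemma rkdot_cauchy_schwarz u v : rkbounded K u -> rkbounded K v ->
  rkdot K u v ^+ 2 <= rknorm2 K u * rknorm2 K v.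
Proof.
move=> ub vb.
have H a b : 0 <= a ^+ 2 * rknorm2 K u + 2 * a * b * rkdot K u v +
    b ^+ 2 * rknorm2 K v.
  have aub := rkboundedZ a ub; have bvb := rkboundedZ b vb.
  have := rknorm2_ge0 (rkboundedD aub bvb).
  rewrite rknorm2D// !rknorm2Z// rkdotZl// rkdotC// rkdotZl// rkdotC//.
  by congr (0 <= _); ring.
have u0 := rknorm2_ge0 ub; have v0 := rknorm2_ge0 vb.
move: H u0 v0; move: (rknorm2 K u) (rknorm2 K v) (rkdot K u v) => p q d H p0 q0.
have [q00|qN0] := eqVneq q 0; last first.
  have qp : 0 < q by rewrite lt_def qN0.
  have := H q (- d).
  rewrite (_ : _ + _ = q * (p * q - d ^+ 2)); last ring.
  by rewrite pmulr_rge0// subr_ge0.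
by have := H (- d) (p + 1); rewrite q00; have := sqr_ge0 d; nra.
Qed.

(* The complexification of the real reproducing kernel Hilbert space of [K]. *)
Definition rkhs_pred : {pred Z -> R[i]} :=
  mem [set f : Z -> R[i] | rkbounded K (fun z => complex.Re (f z)) /\
                           rkbounded K (fun z => complex.Im (f z))].

Record rkhs := RKHS { rkhs_fun :> Z -> R[i]; rkhsP : rkhs_fun \in rkhs_pred }.

HB.instance Definition _ := [isSub for rkhs_fun].
HB.instance Definition _ := [Choice of rkhs by <:].

Lemma ReZ_fun (l : R[i]) (f : Z -> R[i]) : (fun z => complex.Re ((l *: f) z)) =
  complex.Re l *: (fun z => complex.Re (f z)) - complex.Im l *: (fun z => complex.Im (f z)).
Proof.
apply/funext => z; change (complex.Re (l * f z) =
  complex.Re l * complex.Re (f z) - complex.Im l * complex.Im (f z)).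
by case: l (f z) => a b [c d].
Qed.

Lemma ImZ_fun (l : R[i]) (f : Z -> R[i]) : (fun z => complex.Im ((l *: f) z)) =
  complex.Re l *: (fun z => complex.Im (f z)) + complex.Im l *: (fun z => complex.Re (f z)).
Proof.
apply/funext => z; change (complex.Im (l * f z) =
  complex.Re l * complex.Im (f z) + complex.Im l * complex.Re (f z)).
by case: l (f z) => a b [c d].
Qed.

Lemma ReD_fun (f g : Z -> R[i]) : (fun z => complex.Re ((f + g) z)) =
  (fun z => complex.Re (f z)) + (fun z => complex.Re (g z)).
Proof. by apply/funext => z; rewrite /= raddfD. Qed.

Lemma ImD_fun (f g : Z -> R[i]) : (fun z => complex.Im ((f + g) z)) =
  (fun z => complex.Im (f z)) + (fun z => complex.Im (g z)).
Proof. by apply/funext => z; rewrite /= raddfD. Qed.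

Lemma rkhs_submod_closed : submod_closed rkhs_pred.
Proof.
split=> [|l f g].
  by rewrite inE /=; split; exact: rkbounded0.
rewrite !inE /= => -[fr fi] [gr gi]; split.
  rewrite ReD_fun ReZ_fun; apply: rkboundedD => //.
  by apply: rkboundedB; exact: rkboundedZ.
rewrite ImD_fun ImZ_fun; apply: rkboundedD => //.
by apply: rkboundedD; exact: rkboundedZ.
Qed.

HB.instance Definition _ :=
  GRing.isSubmodClosed.Build R[i] (Z -> R[i]) rkhs_pred rkhs_submod_closed.
HB.instance Definition _ := [SubChoice_isSubLmodule of rkhs by <:].

Definition rkre (f : rkhs) : Z -> R := fun z => complex.Re (f z).
Definition rkim (f : rkhs) : Z -> R := fun z => complex.Im (f z).

Lemma rkre_bounded f : rkbounded K (rkre f).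
Proof. by have := rkhsP f; rewrite inE => -[]. Qed.

Lemma rkim_bounded f : rkbounded K (rkim f).
Proof. by have := rkhsP f; rewrite inE => -[]. Qed.

Hint Resolve rkre_bounded rkim_bounded : core.

Lemma rkreD f g : rkre (f + g) = rkre f + rkre g. Proof. exact: ReD_fun. Qed.
Lemma rkimD f g : rkim (f + g) = rkim f + rkim g. Proof. exact: ImD_fun. Qed.
Lemma rkreZ l f : rkre (l *: f) = complex.Re l *: rkre f - complex.Im l *: rkim f.
Proof. exact: ReZ_fun. Qed.
Lemma rkimZ l f : rkim (l *: f) = complex.Re l *: rkim f + complex.Im l *: rkre f.
Proof. exact: ImZ_fun. Qed.

Definition rkhs_norm2 (f : rkhs) : R := rknorm2 K (rkre f) + rknorm2 K (rkim f).

Definition rkhs_norm (f : rkhs) : R[i] := (Num.sqrt (rkhs_norm2 f))%:C%C.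

Lemma rkhs_norm2_ge0 f : 0 <= rkhs_norm2 f.
Proof. by rewrite addr_ge0 ?rknorm2_ge0. Qed.

Definition rkhs_dot (f g : rkhs) : R[i] :=
  ((rkdot K (rkre f) (rkre g) + rkdot K (rkim f) (rkim g)) +i*
   (rkdot K (rkim f) (rkre g) - rkdot K (rkre f) (rkim g)))%C.

Lemma rkhs_normD f g : rkhs_norm (f + g) <= rkhs_norm f + rkhs_norm g.
Proof.
rewrite /rkhs_norm -rmorphD lecR.
have f0 := rkhs_norm2_ge0 f; have g0 := rkhs_norm2_ge0 g.
rewrite -ler_sqr ?nnegrE ?sqrtr_ge0 ?addr_ge0 ?sqrtr_ge0//.
rewrite sqrrD !sqr_sqrtr ?rkhs_norm2_ge0// -mulr_natl -sqrtrM//.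
rewrite /rkhs_norm2 rkreD rkimD !rknorm2D//.
have h : (rkdot K (rkre f) (rkre g) + rkdot K (rkim f) (rkim g)) ^+ 2 <=
    rkhs_norm2 f * rkhs_norm2 g.
  by apply: sqrD_le_mul; rewrite ?rknorm2_ge0// rkdot_cauchy_schwarz.
have {h} : rkdot K (rkre f) (rkre g) + rkdot K (rkim f) (rkim g) <=
    Num.sqrt (rkhs_norm2 f * rkhs_norm2 g).
  by rewrite (le_trans (ler_norm _))// -sqrtr_sqr ler_wsqrtr.
rewrite /rkhs_norm2; lra.
Qed.

Lemma rkhs_normZ (l : R[i]) f : rkhs_norm (l *: f) = `|l| * rkhs_norm f.
Proof.
rewrite /rkhs_norm normc_def -rmorphM -sqrtrM ?addr_ge0 ?sqr_ge0//.
congr (Num.sqrt _)%:C%C; rewrite /rkhs_norm2 rkreZ rkimZ.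
case: l => a b /=.
have ar := rkboundedZ a (rkre_bounded f); have ai := rkboundedZ a (rkim_bounded f).
have br := rkboundedZ b (rkre_bounded f); have bi := rkboundedZ (- b) (rkim_bounded f).
rewrite -scaleNr !rknorm2D// !rknorm2Z// !rkdotZl//.
rewrite (rkdotC (rkre_bounded f) bi) (rkdotC (rkim_bounded f) br) !rkdotZl//.
rewrite (rkdotC (rkim_bounded f) (rkre_bounded f)); ring.
Qed.

Lemma rkhs_norm_eq0 f : rkhs_norm f = 0 -> f = 0.
Proof.
move=> /eqP; rewrite -[0]/(0%:C%C) (inj_eq (@complexI _)) sqrtr_eq0 => f0.
have fr := rknorm2_ge0 (rkre_bounded f); have fi := rknorm2_ge0 (rkim_bounded f).
have zero u : rkbounded K u -> rknorm2 K u = 0 -> forall z, u z = 0.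
  move=> ub u0 z; have := ev_le_rknorm2 [:: (1, z)] ub.
  rewrite u0 mul0r /ev big_seq1 mul1r => h.
  by apply/eqP; rewrite -sqrf_eq0 eq_le h sqr_ge0.
rewrite /rkhs_norm2 in f0.
apply/val_inj/funext => z /=.
have := zero _ (rkre_bounded f) ltac:(lra) z.
have := zero _ (rkim_bounded f) ltac:(lra) z.
by rewrite /rkre /rkim; case: (rkhs_fun f z) => a b /= -> ->.
Qed.

HB.instance Definition _ := Lmodule_isNormed.Build R[i] rkhs
  rkhs_normD rkhs_normZ rkhs_norm_eq0.

Definition rknorm (f : rkhs) : R := Num.sqrt (rkhs_norm2 f).

Lemma rkhs_normE f : `|f| = (rknorm f)%:C%C. Proof. by []. Qed.

Lemma rkre_le f : rknorm2 K (rkre f) <= rknorm f ^+ 2.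
Proof. by rewrite sqr_sqrtr ?rkhs_norm2_ge0// lerDl rknorm2_ge0. Qed.

Lemma rkim_le f : rknorm2 K (rkim f) <= rknorm f ^+ 2.
Proof. by rewrite sqr_sqrtr ?rkhs_norm2_ge0// lerDr rknorm2_ge0. Qed.

Lemma rkreB f g : rkre (f - g) = rkre f - rkre g.
Proof. by rewrite rkreD; congr (_ + _); apply/funext => z; rewrite /rkre raddfN. Qed.

Lemma rkimB f g : rkim (f - g) = rkim f - rkim g.
Proof. by rewrite rkimD; congr (_ + _); apply/funext => z; rewrite /rkim raddfN. Qed.

Section Completeness.
Variables (F : set_system rkhs) (FF : ProperFilter F).
Hypothesis F_cauchy : forall e : R, 0 < e ->
  exists2 A, F A & forall f g, A f -> A g -> rknorm (f - g) <= e.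

(* [p] is [rkre] or [rkim]. *)
Variable p : rkhs -> Z -> R.
Hypothesis p_bounded : forall f, rkbounded K (p f).
Hypothesis pB : forall f g, p (f - g) = p f - p g.
Hypothesis p_le : forall f, rknorm2 K (p f) <= rknorm f ^+ 2.

(** Evaluation at [z] is bounded by [sqrt (K z z)] times the norm, so a filter that is Cauchy in
    norm is Cauchy at every point. *)
Lemma rkhs_pointwise_cvg z : cvg (p f z @[f --> F]).
Proof.
apply: cauchy_cvg; apply/cauchy_ballP => e e0.
(* Unlike the square root itself, [C] is positive and can be divided by. *)
have [C C0 CK] : exists2 C, 0 < C & Num.sqrt (K z z) <= C.
  by exists (Num.sqrt (K z z) + 1); rewrite ?ltr_wpDl ?sqrtr_ge0// lerDl.
have d0 : 0 < e / 2 / C by rewrite !divr_gt0.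
have [A FA Ae] := F_cauchy d0.
exists (p ^~ z @` A, p ^~ z @` A) => /=.
  by split; apply: (@filterS _ F _ A) => // f Af /=; exists f.
move=> [_ _] /= [[f Af <-] [g Ag <-]].
have fg := Ae _ _ Af Ag.
have h : (p f z - p g z) ^+ 2 <= (e / 2) ^+ 2.
  have := ev_le_rknorm2 [:: (1, z)] (p_bounded (f - g)).
  rewrite gram1 /ev big_seq1 mul1r pB => /le_trans; apply.
  have -> : (e / 2) ^+ 2 = (e / 2 / C) ^+ 2 * C ^+ 2.
    by rewrite -exprMn divfK// gt_eqF.
  have Kz0 : 0 <= K z z by rewrite -gram1 gram_ge0.
  apply: ler_pM => //; first by rewrite rknorm2_ge0// -pB.
    rewrite -pB (le_trans (p_le _))// ler_sqr ?nnegrE ?sqrtr_ge0//.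
    exact: ltW.
  by rewrite -(sqr_sqrtr Kz0) ler_sqr ?nnegrE ?sqrtr_ge0// ltW.
have {}h : `|p f z - p g z| <= e / 2.
  by rewrite -ler_sqr ?nnegrE ?divr_ge0 ?(ltW e0)// real_normK ?num_real.
rewrite /ball /=; apply: le_lt_trans h _; lra.
Qed.

(** The limit is the pointwise one: the bound on [ev (p f - p g) t] is uniform in [t] and survives
    the limit in [g]. This also bounds [l], as a difference of bounded functions. *)
Lemma rkhs_cvg_part : exists l, [/\ rkbounded K l & forall e : R, 0 < e ->
  \forall f \near F, rknorm2 K (p f - l) <= e ^+ 2].
Proof.
pose l z := lim (p f z @[f --> F]).
have evl t : ev (p f) t @[f --> F] --> ev l t.
  elim: t => [|q t IH].
    rewrite ev_nil; under eq_fun do rewrite ev_nil; exact: cvg_cst.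
  rewrite ev_cons; under eq_fun do rewrite ev_cons.
  by apply: cvgD => //; apply: cvgMr; exact: rkhs_pointwise_cvg.
have le e : 0 < e -> \forall f \near F,
    forall t, ev (p f - l) t ^+ 2 <= e ^+ 2 * gram K t t.
  move=> /F_cauchy[A FA Ae]; apply: filterS (FA) => f Af t.
  have h : (ev (p f) t - ev (p g) t) ^+ 2 @[g --> F] -->
      (ev (p f) t - ev l t) ^+ 2.
    have h1 : ev (p f) t - ev (p g) t @[g --> F] --> ev (p f) t - ev l t.
      by apply: cvgB => //; exact: cvg_cst.
    by rewrite expr2; under eq_fun do rewrite expr2; exact: cvgM.
  rewrite evB -(cvg_lim _ h)//; apply: limr_le; first by apply/cvg_ex; eexists; exact: h.
  apply: filterS FA => g Ag; rewrite -evB -pB.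
  apply: (le_trans (ev_le_rknorm2 _ (p_bounded _))).
  rewrite ler_wpM2r ?gram_ge0// (le_trans (p_le _))//.
  by rewrite ler_sqr ?nnegrE ?sqrtr_ge0// ?Ae// (le_trans _ (Ae _ _ Af Ag))// sqrtr_ge0.
exists l; split; last first.
  move=> e e0; apply: filterS (le _ e0) => f fl.
  by apply: rknorm2_le => //; exact: sqr_ge0.
have [f fl] := filter_ex (le 1 ltr01).
rewrite -[l](subKr (p f)); apply: rkboundedB => //.
by exists (1 ^+ 2).
Qed.

End Completeness.

Lemma rkhs_complete (F : set_system rkhs) : ProperFilter F -> cauchy F -> cvg F.
Proof.
move=> FF /cauchy_ballP Fc.
have F_cauchy : forall e : R, 0 < e ->
    exists2 A, F A & forall f g, A f -> A g -> rknorm (f - g) <= e.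
  move=> e e0; have ec0 : 0 < (e / 2)%:C%C :> R[i] by rewrite ltcR divr_gt0.
  have [[A B] /= [FA FB] AB] := Fc _ ec0.
  exists (A `&` B) => [|f g [Af Bf] [Ag Bg]]; first exact: filterI.
  have := AB (f, g) (conj Af Bg); rewrite -ball_normE/= rkhs_normE ltcR => h.
  by rewrite ltW// (lt_le_trans h)// ler_pdivrMr// ler_peMr ?ltW// ltr1n.
have [u [ub Fu]] := rkhs_cvg_part FF F_cauchy rkre_bounded rkreB rkre_le.
have [v [vb Fv]] := rkhs_cvg_part FF F_cauchy rkim_bounded rkimB rkim_le.
have lP : (fun z => u z +i* v z)%C \in rkhs_pred by rewrite inE.
pose l := RKHS lP.
apply/cvg_ex; exists l; apply/cvgrPdist_lt => /= e e0.
(* A positive element of [R[i]] is real. *)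
have : exists2 r : R, 0 < r & r%:C%C = e.
  by exists (complex.Re e); move: e0; rewrite ltcE /= => /andP[/eqP ie re]//;
    apply/eqP; rewrite eq_complex /= eqxx ie eqxx.
move=> [r r0 <-]; have r20 : 0 < r / 2 by rewrite divr_gt0.
apply: filterS2 (Fu _ r20) (Fv _ r20) => f fu fv.
rewrite -normrN opprB rkhs_normE ltcR.
rewrite -ltr_sqr ?nnegrE ?sqrtr_ge0 ?ltW// sqr_sqrtr ?rkhs_norm2_ge0//.
by rewrite /rkhs_norm2 rkreB rkimB; nra.
Qed.

HB.instance Definition _ := Uniform_isComplete.Build rkhs rkhs_complete.

Lemma rkhs_dotDl f g w : rkhs_dot (f + g) w = rkhs_dot f w + rkhs_dot g w.
Proof.
apply/eqP; rewrite eq_complex /= rkreD rkimD !rkdotDl//.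
by apply/andP; split; apply/eqP; ring.
Qed.

Lemma rkhs_dotZl l f g : rkhs_dot (l *: f) g = l * rkhs_dot f g.
Proof.
have zb c (h : rkhs -> Z -> R) (hb : forall k, rkbounded K (h k)) k :=
  rkboundedZ c (hb k).
have re a := zb a rkre rkre_bounded f; have im a := zb a rkim rkim_bounded f.
case: l => a b; apply/eqP; rewrite eq_complex /= rkreZ rkimZ /=.
rewrite -[- (b *: rkim f)]scaleNr !rkdotDl// !rkdotZl//.
by apply/andP; split; apply/eqP; ring.
Qed.

Lemma rkhs_dotC f g : rkhs_dot f g = (rkhs_dot g f)^*.
Proof.
have -> : (rkhs_dot g f)^* = ((rkhs_dot g f)^*)%C by [].
apply/eqP; rewrite eq_complex /=.
rewrite (rkdotC (rkre_bounded f) (rkre_bounded g)).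
rewrite (rkdotC (rkim_bounded f) (rkim_bounded g)).
rewrite (rkdotC (rkre_bounded f) (rkim_bounded g)).
rewrite (rkdotC (rkim_bounded f) (rkre_bounded g)).
by rewrite opprB !eqxx.
Qed.

Lemma rkhs_dot_norm f : rkhs_dot f f = `|f| ^+ 2.
Proof.
rewrite rkhs_normE -rmorphXn/= sqr_sqrtr ?rkhs_norm2_ge0//.
apply/eqP; rewrite eq_complex /= !rkdotff// eqxx/=.
by rewrite (rkdotC (rkim_bounded f)) ?subrr.
Qed.

Lemma rkhs_dot_bilinear : bilinear_for ( *%R : R[i] -> R[i] -> R[i])
  (Num.conj \; *%R) rkhs_dot.
Proof.
split=> [w l f g|w l f g] /=; first by rewrite rkhs_dotDl rkhs_dotZl.
rewrite rkhs_dotC rkhs_dotDl rkhs_dotZl rmorphD rmorphM /=.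
by rewrite -!rkhs_dotC.
Qed.

HB.instance Definition _ := bilinear_isBilinear.Build R[i] rkhs rkhs R[i]
  ( *%R) (Num.conj \; *%R) rkhs_dot rkhs_dot_bilinear.

Lemma rkhs_dot_hermitian f g :
  rkhs_dot f g = (-1) ^+ false * (rkhs_dot g f)^*.
Proof. by rewrite expr0 mul1r rkhs_dotC. Qed.

HB.instance Definition _ := isHermitianSesquilinear.Build R[i] rkhs false
  (@Num.conj R[i]) rkhs_dot rkhs_dot_hermitian.

Lemma rkhs_dot_gt0 f : f != 0 -> 0 < rkhs_dot f f.
Proof. by move=> f0; rewrite rkhs_dot_norm exprn_gt0// normr_gt0. Qed.

HB.instance Definition _ := isDotProduct.Build R[i] rkhs rkhs_dot rkhs_dot_gt0.

HB.instance Definition _ := isHilbert.Build R rkhs rkhs_dot_norm.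

End Complexification.

(** * Property (T) for permutation representations *)

Section TopologicalGroup.
Context {G : topologicalGroupType}.

Lemma near_mulgV (P : set G) (g0 : G) :
  nbhs (1%g : G) P -> \forall g \near g0, P (g * g0^-1)%g.
Proof.
move=> P1.
have c : {for g0, continuous (fun g : G => (g * g0^-1)%g)}.
  move=> U; rewrite /= => Ug.
  have := @mulg_continuous G (g0, g0^-1%g) U Ug.
  move=> [[A B] /= [Ag Bg] AB]; apply: filterS Ag => h Ah.
  by apply: (AB (h, g0^-1%g)); split => //; exact: nbhs_singleton Bg.
by apply: c; rewrite /= divgg.
Qed.

Lemma near_conjg (P : set G) (h : G) :
  nbhs (1%g : G) P -> \forall g \near (1%g : G), P (h * g * h^-1)%g.
Proof.
move=> P1.
have hh : (h * 1 * h^-1)%g = 1%g :> G by rewrite mulg1 mulgV.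
have c : {for 1%g, continuous (fun g : G => (h * g * h^-1)%g)}.
  move=> U; rewrite /= => Ug.
  have [[A B] /= [Ag Bg] AB] := @mulg_continuous G ((h * 1)%g, h^-1%g) U Ug.
  have [[A' B'] /= [Ag' Bg'] AB'] := @mulg_continuous G (h, 1%g) A Ag.
  apply: filterS Bg' => g B'g.
  apply: (AB ((h * g)%g, h^-1%g)); split => /=; last exact: nbhs_singleton Bg.
  by apply: (AB' (h, g)); split => //; exact: nbhs_singleton Ag'.
by apply: c; rewrite /= hh.
Qed.

(** Otherwise the parts of [K] left uncovered by finitely many right translates [U h] generate a
    proper filter. At a cluster point [p], the neighbourhood [U p] misses the part left by
    [[:: p]]. *)
Lemma compact_finite_translates (K U : set G) : compact K -> nbhs (1%g : G) U ->
  exists L : seq G, forall g, K g -> exists2 h, h \in L & U (g * h^-1)%g.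
Proof.
move=> Kc U1; apply: contrapT => nL.
pose out (L : seq G) := [set g | K g /\ forall h, h \in L -> ~ U (g * h^-1)%g].
pose F : set_system G := [set A | exists L, out L `<=` A].
have FF : ProperFilter F.
  split.
    move=> [L L0]; apply: nL; exists L => g Kg.
    apply: contrapT => nh; apply: (L0 g); split=> // h hL Ugh.
    by apply: nh; exists h.
  split.
  - by exists [::].
  - move=> A B [LA oA] [LB oB]; exists (LA ++ LB) => g [Kg gL]; split.
      by apply: oA; split=> // h hL; apply: gL; rewrite mem_cat hL.
    by apply: oB; split=> // h hL; apply: gL; rewrite mem_cat hL orbT.
  - by move=> A B AB [L oA]; exists L; exact: subset_trans oA AB.
have FK : F K by exists [::] => g [].
have [p [Kp clp]] := Kc F FF FK.
have Fp : F (out [:: p]) by exists [:: p].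
have [g [[_ nU] Ug]] := clp _ _ Fp (near_mulgV p U1).
by apply: nU Ug; rewrite mem_head.
Qed.

End TopologicalGroup.

(** * The unitary representation on the space of an invariant kernel *)

Section PermutationRepresentation.
Context {R : realType} {G : topologicalGroupType} {Z : Type}.
Variables (K : @kernel R Z) (act : G -> Z -> Z).
Hypothesis act1 : forall z, act 1%g z = z.
Hypothesis actM : forall g h z, act (g * h)%g z = act g (act h z).
Hypothesis actK : forall g z w, K (act g z) (act g w) = K z w.

Definition translate (T : Type) (g : G) (f : Z -> T) : Z -> T :=
  fun z => f (act g^-1%g z).

Lemma translateM T g h (f : Z -> T) :
  translate (g * h)%g f = translate g (translate h f).
Proof. by apply/funext => z; rewrite /translate invgM actM. Qed.

Lemma translate1 T (f : Z -> T) : translate 1%g f = f.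
Proof. by apply/funext => z; rewrite /translate invg1 act1. Qed.

Definition actt (g : G) (t : seq (R * Z)) := [seq (p.1, act g p.2) | p <- t].

Lemma ev_translate g (f : Z -> R) t : ev (translate g f) t = ev f (actt g^-1%g t).
Proof. by rewrite /ev big_map. Qed.

Lemma gram_actt g s t : gram K (actt g s) (actt g t) = gram K s t.
Proof.
rewrite /gram /ev big_map; apply: eq_bigr => p _; rewrite big_map.
by congr (_ * _); apply: eq_bigr => q _; rewrite actK.
Qed.

Lemma rkbounded_translate g (f : Z -> R) :
  rkbounded K f -> rkbounded K (translate g f).
Proof.
by move=> [M fM]; exists M => t; rewrite ev_translate -(gram_actt g^-1%g).
Qed.

Lemma rknorm2_translate g (f : Z -> R) :
  rkbounded K f -> rknorm2 K (translate g f) = rknorm2 K f.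
Proof.
have le h (u : Z -> R) : rkbounded K u ->
    rknorm2 K (translate h u) <= rknorm2 K u.
  move=> ub; apply: rknorm2_le => [t|]; last exact: rknorm2_ge0.
  by rewrite ev_translate -(gram_actt h^-1%g) ev_le_rknorm2.
move=> fb; apply/eqP; rewrite eq_le le//=.
rewrite -[X in rknorm2 K X <= _]translate1 -(mulVg g) translateM.
by apply: le; exact: rkbounded_translate.
Qed.

Lemma translateD g (f h : Z -> R) : translate g (f + h) = translate g f + translate g h.
Proof. by []. Qed.

Lemma translateB g (f h : Z -> R) : translate g (f - h) = translate g f - translate g h.
Proof. by []. Qed.

Lemma translateZ g a (f : Z -> R) : translate g (a *: f) = a *: translate g f.
Proof. by []. Qed.

Lemma translate_rkhsP g (f : rkhs K) : translate g f \in rkhs_pred K.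
Proof.
rewrite inE /=; split.
  exact: (rkbounded_translate g (rkre_bounded f)).
exact: (rkbounded_translate g (rkim_bounded f)).
Qed.

Definition rkrep (g : G) (f : rkhs K) : rkhs K := RKHS (translate_rkhsP g f).

Lemma rkre_rep g f : rkre (rkrep g f) = translate g (rkre f). Proof. by []. Qed.
Lemma rkim_rep g f : rkim (rkrep g f) = translate g (rkim f). Proof. by []. Qed.

Lemma rkrepM g h : rkrep (g * h)%g = rkrep g \o rkrep h.
Proof. by apply/funext => f; apply/val_inj; exact: translateM. Qed.

Lemma rkrep_inv g : cancel (rkrep g) (rkrep g^-1%g).
Proof.
move=> f; apply/val_inj => /=.
by rewrite -[LHS]translateM mulVg translate1.
Qed.

Lemma rkdot_translate g (u v : Z -> R) : rkbounded K u -> rkbounded K v ->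
  rkdot K (translate g u) (translate g v) = rkdot K u v.
Proof.
move=> ub vb; rewrite /rkdot -translateD -translateB !rknorm2_translate//.
- exact: rkboundedB.
- exact: rkboundedD.
Qed.

Lemma rkrep_unitary : unitary_rep rkrep.
Proof.
split=> [g|]; last exact: rkrepM.
split.
- by move=> a f h; apply/val_inj.
- exists (rkrep g^-1%g); first exact: rkrep_inv.
  by have := rkrep_inv g^-1%g; rewrite invgK.
- move=> f h.
  change (rkhs_dot (rkrep g f) (rkrep g h) = rkhs_dot f h).
  rewrite /rkhs_dot !rkre_rep !rkim_rep.
  have rf := rkre_bounded f; have jf := rkim_bounded f.
  have rh := rkre_bounded h; have jh := rkim_bounded h.
  by rewrite !rkdot_translate.
Qed.

Hypothesis translate_cont : forall d : R, 0 < d ->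
  \forall y \near (1%g : G), forall f : Z -> R, rkbounded K f ->
    rknorm2 K (translate y f - f) <= d * rknorm2 K f.

Lemma rkrep_continuous : strongly_continuous_rep rkrep.
Proof.
split; first exact: rkrep_unitary.
move=> f g0; apply/cvgrPdist_lt => e e0.
have [r r0 <-] : exists2 r : R, 0 < r & r%:C%C = e.
  by exists (complex.Re e); move: e0; rewrite ltcE /= => /andP[/eqP ie re]//;
    apply/eqP; rewrite eq_complex /= eqxx ie eqxx.
have d0 : 0 < r ^+ 2 / (rkhs_norm2 f + 1).
  by rewrite divr_gt0 ?exprn_gt0// ltr_wpDl ?rkhs_norm2_ge0.
apply: filterS (near_mulgV g0 (translate_cont d0)) => g Hg.
rewrite -normrN opprB rkhs_normE ltcR.
rewrite -ltr_sqr ?nnegrE ?sqrtr_ge0 ?(ltW r0)// sqr_sqrtr ?rkhs_norm2_ge0//.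
have E : rkrep g f - rkrep g0 f = rkrep (g * g0^-1)%g (rkrep g0 f) - rkrep g0 f.
  have := rkrepM (g * g0^-1)%g g0; rewrite -mulgA mulVg mulg1 => ->.
  by [].
rewrite E /rkhs_norm2 rkreB rkimB rkre_rep rkim_rep.
have h1 := Hg _ (rkre_bounded (rkrep g0 f)).
have h2 := Hg _ (rkim_bounded (rkrep g0 f)).
apply: (le_lt_trans (lerD h1 h2)).
rewrite -mulrDr rkre_rep rkim_rep !rknorm2_translate; [|exact: rkim_bounded|exact: rkre_bounded].
rewrite -/(rkhs_norm2 f) mulrAC ltr_pdivrMr; last by rewrite ltr_wpDl ?rkhs_norm2_ge0.
by rewrite ltr_pM2l ?exprn_gt0// ltrDl.
Qed.

Hypothesis no_invariant : forall f : Z -> R, rkbounded K f ->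
  (forall g, translate g f = f) -> forall z, f z = 0.

(** Without invariant vectors, property (T) excludes almost invariant ones: for some [eps] and some
    compact set, every unit vector is moved by at least [eps] by an element of that set. Uniform
    continuity replaces the compact set by a finite net. *)
Lemma property_T_gap : property_T R G ->
  exists c : R, exists2 L : seq G, 0 < c & forall f : Z -> R, rkbounded K f ->
    exists2 g, g \in L & c * rknorm2 K f <= rknorm2 K (translate g f - f).
Proof.
move=> GT.
have noinv : ~ invariant_unit_vector rkrep.
  move=> [f f1 fg].
  have r0 := no_invariant (rkre_bounded f) (fun g => congr1 (@rkre _ _ _) (fg g)).
  have i0 := no_invariant (rkim_bounded f) (fun g => congr1 (@rkim _ _ _) (fg g)).
  have f0 : f = 0.
    apply/val_inj/funext => z /=; move: (r0 z) (i0 z); rewrite /rkre /rkim.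
    by case: (rkhs_fun f z) => a b /= -> ->.
  by move: f1; rewrite f0 normr0 => /eqP; rewrite eq_sym oner_eq0.
have /existsNP[eps /existsNP[C /not_implyP[eps0 /not_implyP[Cc H]]]] :
    ~ almost_invariant_vectors rkrep.
  by move=> ai; apply: noinv; apply: GT => //; exact: rkrep_continuous.
have d0 : 0 < eps ^+ 2 / 8 by rewrite divr_gt0 ?exprn_gt0.
have [L CL] := compact_finite_translates Cc (translate_cont d0).
(* For [h] in the net with [|gf - hf|^2 <= eps^2 / 8 |f|^2], the bound [|gf - f|^2 <= 2 |gf - hf|^2
   + 2 |hf - f|^2] leaves [|hf - f|^2 >= 3/8 eps^2 |f|^2]. The neutral element serves the [f] of
   norm zero. *)
exists (eps ^+ 2 / 4), (1%g :: L) => [|f fb]; first by rewrite divr_gt0 ?exprn_gt0.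
have f0 := rknorm2_ge0 fb.
have [f00|fN0] := eqVneq (rknorm2 K f) 0.
  exists 1%g; first exact: mem_head.
  rewrite f00 mulr0; apply: rknorm2_ge0; apply: rkboundedB => //.
  exact: rkbounded_translate.
have fp : 0 < rknorm2 K f by rewrite lt_def fN0.
pose a := (Num.sqrt (rknorm2 K f))^-1.
have a2 : a ^+ 2 = (rknorm2 K f)^-1 by rewrite exprVn sqr_sqrtr.
have xiP : (fun z => (a * f z)%:C%C) \in rkhs_pred K.
  by rewrite inE /=; split; [exact: (rkboundedZ a fb)|exact: rkbounded0].
pose xi := RKHS xiP.
have rexi : rkre xi = a *: f by [].
have imxi : rkim xi = 0 by [].
have n0 : rknorm2 K (0 : Z -> R) = 0.
  by rewrite -(scale0r f) rknorm2Z// expr0n mul0r.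
have xi1 : `|xi| = 1.
  rewrite rkhs_normE /rknorm /rkhs_norm2 rexi imxi n0 addr0 rknorm2Z// a2.
  by rewrite mulVf// sqrtr1.
have [g Cg gxi] : exists2 g, C g & ~ (`|xi - rkrep g xi| < eps%:C%C).
  apply: contrapT => nog; apply: H; exists xi => // g Cg.
  by apply: contrapT => ng; apply: nog; exists g.
have gfb := rkbounded_translate g fb.
have gf : eps ^+ 2 * rknorm2 K f <= rknorm2 K (translate g f - f).
  move: gxi => /negP; rewrite rkhs_normE ltcR -leNgt => h.
  have {h} : eps ^+ 2 <= rkhs_norm2 (xi - rkrep g xi).
    rewrite -[leRHS]sqr_sqrtr ?rkhs_norm2_ge0// ler_sqr ?nnegrE ?sqrtr_ge0//.
    exact: ltW.
  rewrite /rkhs_norm2 rkreB rkimB rkre_rep rkim_rep rexi imxi translateZ.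
  have -> : translate g (0 : Z -> R) = 0 by [].
  rewrite subr0 n0 addr0 -scalerBr rknorm2Z; last exact: rkboundedB.
  rewrite a2 -(rknorm2N (rkboundedB fb gfb)) opprB ler_pdivlMl//.
  by rewrite mulrC.
have [h hL] := CL g Cg; have hfb := rkbounded_translate h fb.
move=> /(_ _ hfb); rewrite -translateM -mulgA mulVg mulg1 rknorm2_translate//.
move=> gh; exists h; first by rewrite in_cons hL orbT.
have hb := rkboundedB hfb fb; have ghb := rkboundedB gfb hfb.
have := rknorm2_parallelogram ghb hb; rewrite addrA subrK.
have := rknorm2_ge0 (rkboundedB ghb hb).
have := mulr_ge0 (sqr_ge0 eps) f0.
move: gf gh; lra.
Qed.

End PermutationRepresentation.

(** * Functions on extremely amenable groups *)

Section ExtremelyAmenable.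
Import ArrowAsProduct.

Lemma cvg_arrow_prod (J : eqType) (T : topologicalType) (X : Type)
    (F : set_system X) (FF : Filter F) (f : X -> {ptws J -> T}) (p : {ptws J -> T}) :
  (forall j, f x j @[x --> F] --> p j) -> f @ F --> p.
Proof.
move=> fp; apply/cvg_sup => j; apply/cvg_image.
  rewrite eqEsubset; split => y //= _.
  by exists (@dfwith J (fun _ => T) (fun _ => p j) j y) => //; rewrite dfwithin.
move=> U /(fp j) /= FU; exists (@proj J (fun _ => T) j @^-1` U) => //.
rewrite eqEsubset; split => [_ [q qU <-] //|y Uy].
by exists (@dfwith J (fun _ => T) (fun _ => p j) j y); rewrite /= ?dfwithin// /preimage/= /proj dfwithin.
Qed.

Context {R : realType} {G : topologicalGroupType} {I : finType}.
Variable f : I -> G -> R.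
Hypothesis f_bounded : forall i, exists M : R, forall x, `|f i x| <= M.
Hypothesis f_uc : forall i (d : R), 0 < d ->
  \forall y \near (1%g : G), forall x, `|f i (y * x)%g - f i x| <= d.

Notation P := {ptws (I * G) -> R}.

(** A group element is encoded by the values of all [f i] on its left translates, so that left
    multiplication becomes the change of coordinates [shift], which extends to the closure. *)
Definition orbit_pt (x : G) : P := fun ih => f ih.1 (ih.2 * x)%g.

Definition orbit_closure : set P := closure (range orbit_pt).

Definition shift (g : G) (p : P) : P := fun ih => p (ih.1, (ih.2 * g)%g).

Lemma orbit_closure_approx p (s : seq (I * G)) (d : R) : orbit_closure p -> 0 < d ->
  exists x, forall ih, ih \in s -> `|p ih - orbit_pt x ih| < d.
Proof.
move=> Xp d0.
have /Xp [_ [[x _ <-] /= xs]] :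
    nbhs p [set q : P | forall ih, ih \in s -> `|p ih - q ih| < d].
  elim: s => [|c s IH]; first by apply: filterS filterT => q _ ih.
  have hc : nbhs p [set q : P | `|p c - q c| < d].
    have h : (q c @[q --> p] --> (p c : R)).
      exact: (@proj_continuous _ (fun _ : I * G => R : topologicalType) c p).
    by move/cvgrPdist_lt : h; apply.
  apply: filterS2 hc IH => q qc qs ih; rewrite inE => /predU1P[->//|].
  exact: qs.
by exists x.
Qed.

Lemma orbit_closure_compact : compact orbit_closure.
Proof.
pose M i := projT1 (cid (f_bounded i)).
have fM i x : `|f i x| <= M i by exact: (projT2 (cid (f_bounded i))).
pose B := [set p : P | forall ih, `[- M ih.1, M ih.1]%classic (p ih)].
have Bc : compact B.
  apply: (@tychonoff (I * G)%type (fun _ => R : topologicalType)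
    (fun ih => `[- M ih.1, M ih.1]%classic)) => ih; exact: segment_compact.
apply: (subclosed_compact _ Bc); first exact: closed_closure.
have Bcl : closed B.
  apply: compact_closed Bc; apply: hausdorff_product => _; exact: Rhausdorff.
rewrite /orbit_closure closureE; apply: smallest_sub => // _ [x _ <-] ih /=.
by rewrite in_itv /= -ler_norml fM.
Qed.

Lemma shift_continuous g : continuous (shift g).
Proof.
move=> p; apply: (@cvg_arrow_prod _ (R : topologicalType) _ (nbhs p) _ (shift g) (shift g p)) => ih.
exact: (@proj_continuous _ (fun _ : I * G => R : topologicalType) (ih.1, (ih.2 * g)%g) p).
Qed.

Lemma shift_orbit_pt g x : shift g (orbit_pt x) = orbit_pt (g * x)%g.
Proof. by apply/funext => ih; rewrite /shift /orbit_pt /= mulgA. Qed.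

Lemma orbit_closure_shift g p : orbit_closure p -> orbit_closure (shift g p).
Proof.
move=> Xp U Up.
have [_ [[x _ <-] Ux]] := Xp _ (shift_continuous Up).
exists (orbit_pt (g * x)%g); split; first by exists (g * x)%g.
by rewrite -shift_orbit_pt.
Qed.

Let X : topologicalType := orbit_closure.

Let valX (x : X) : orbit_closure (set_val x). Proof. exact: set_valP. Qed.

Let mkX p (Xp : orbit_closure p) : X :=
  exist (fun q => q \in orbit_closure) p (mem_set Xp).

Let nbhsX (x : X) (U : set X) : nbhs x U ->
  exists2 C : set P, nbhs (set_val x) C & set_val @^-1` C `<=` U.
Proof.
case=> _ /= [] [W oW <-] /= Wx sWU; exists W => //.
exact: open_nbhs_nbhs.
Qed.

Let set_val_nbhs (x : X) (C : set P) : nbhs (set_val x) C ->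
  nbhs x (set_val @^-1` C).
Proof. exact: (@initial_continuous _ _ (set_val : X -> P)). Qed.

Let subtype_compact : compact [set: X].
Proof.
move=> F FF _.
have FX : (set_val @ F) orbit_closure by apply: (@filterS _ F _ setT) => [x _|]; [exact: valX|exact: filterT].
have [p [Xp clp]] := orbit_closure_compact (fmap_proper_filter _ FF) FX.
exists (mkX Xp); split=> // A B FA /nbhsX[C Cp CB].
have FsA : (set_val @ F) [set set_val x | x in A].
  by apply: (@filterS _ F _ A) => // x Ax; exists x.
by have [_ [[x Ax <-] Cx]] := clp _ _ FsA Cp; exists x; split => //; exact: CB.
Qed.

Let subtype_hausdorff : hausdorff_space X.
Proof.
move=> p q pq; apply/val_inj.
have hP : hausdorff_space P by apply: hausdorff_product => _; exact: Rhausdorff.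
apply: hP => A B /set_val_nbhs Ap /set_val_nbhs Bq.
by have [x [Ax Bx]] := pq _ _ Ap Bq; exists (set_val x).
Qed.

Let act (g : G) (x : X) : X :=
  mkX (@orbit_closure_shift g _ (@valX x)).

Let act_continuous : continuous (fun p : G * X => act p.1 p.2).
Proof.
move=> [g0 x0] /= U /nbhsX[C Cp CU].
have h : shift gx.1 (set_val gx.2) @[gx --> (g0, x0)] --> (shift g0 (set_val x0) : P).
  apply: (@cvg_arrow_prod _ (R : topologicalType) _ _ _
    (fun gx : G * X => shift gx.1 (set_val gx.2)) (shift g0 (set_val x0))) => -[i h].
  change (set_val gx.2 (i, (h * gx.1)%g) @[gx --> (g0, x0)] -->
    (set_val x0 (i, (h * g0)%g) : R)).
  apply/cvgrPdist_lt => e e0.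
  have e30 : 0 < e / 3 by rewrite divr_gt0.
  (* Moving from [g0] to [g] changes an orbit point at [(i, h)] by an increment of [f i] under left
     multiplication by [h g g0^-1 h^-1], which is small uniformly over the orbit. *)
  pose A := [set g | forall y,
    `|f i (h * (g * g0^-1) * h^-1 * y)%g - f i y| <= e / 3].
  pose B := [set x : X |
    `|set_val x0 (i, (h * g0)%g) - set_val x (i, (h * g0)%g)| < e / 3].
  have near_g : nbhs g0 A.
    exact: (near_mulgV g0 (near_conjg h (f_uc i e30))).
  have near_x : nbhs x0 B.
    have hq : (q (i, (h * g0)%g) @[q --> set_val x0] --> (set_val x0 (i, (h * g0)%g) : R)).
      exact: (@proj_continuous _ (fun _ : I * G => R : topologicalType) (i, (h * g0)%g) (set_val x0)).
    have hn : nbhs (set_val x0)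
        [set q : P | `|set_val x0 (i, (h * g0)%g) - q (i, (h * g0)%g)| < e / 3].
      by move/cvgrPdist_lt: hq; apply.
    exact: (set_val_nbhs hn).
  exists (A, B) => //.
  move=> [g x] /= [gP xP].
  (* Two approximation errors [e / 12] and the two bounds [e / 3] add up to less than [e]. *)
  have [y yP] := orbit_closure_approx [:: (i, (h * g)%g); (i, (h * g0)%g)] (@valX x) (divr_gt0 e30 (ltr0Sn R 3)).
  have y1 := yP (i, (h * g)%g) (mem_head _ _).
  have y2 : (i, (h * g0)%g) \in [:: (i, (h * g)%g); (i, (h * g0)%g)] by rewrite !inE eqxx orbT.
  move/yP : y2 => y2; have := gP (h * g0 * y)%g.
  rewrite !mulgA mulgVK mulgVK => y3.
  move: y1 y2 y3 xP; rewrite /B /orbit_pt /= !ltr_norml !ler_norml.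
  by move=> /andP[? ?] /andP[? ?] /andP[? ?] /andP[? ?]; apply/andP; split; lra.
have hC : nbhs (g0, x0) [set gx : G * X | C (shift gx.1 (set_val gx.2))] by exact: h.
change (nbhs (g0, x0) [set gx : G * X | U (act gx.1 gx.2)]).
by apply: filterS hC => gx Cgx; exact: CU.
Qed.

(** A fixed point [p] of the orbit closure has equal coordinates at [(i, g i)] and [(i, 1)]. Any [x]
    whose orbit point is close to [p] at these finitely many coordinates will do. *)
Lemma ea_orbit_map : extremely_amenable G -> forall (g : I -> G) (d : R), 0 < d ->
  exists x, forall i, `|f i (g i * x)%g - f i x| < d.
Proof.
move=> ea.
have X0 : [set: X] !=set0.
  have o1 : orbit_closure (orbit_pt 1%g) by apply: subset_closure; exists 1%g.
  by exists (mkX o1).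
have actc : continuous_action act.
  split; last exact: act_continuous.
  - by move=> x; apply/val_inj/funext => -[i h]; rewrite /= /shift /= mulg1.
  - by move=> g h x; apply/val_inj/funext => ih; rewrite /= /shift /= mulgA.
have [p pfix] := ea X subtype_compact subtype_hausdorff X0 act actc.
move=> g d d0.
have d20 : 0 < d / 2 by rewrite divr_gt0.
pose s := [seq (i, g i) | i <- enum I] ++ [seq (i, 1%g) | i <- enum I].
have [x xs] := orbit_closure_approx s (@valX p) d20.
exists x => i.
have h1 : `|set_val p (i, g i) - f i (g i * x)%g| < d / 2.
  by apply: (xs (i, g i)); rewrite mem_cat map_f ?mem_enum.
have h2 : `|set_val p (i, 1%g) - f i (1 * x)%g| < d / 2.
  by apply: (xs (i, 1%g)); rewrite mem_cat orbC (map_f (fun i => (i, 1%g))) ?mem_enum.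
have E : set_val p (i, g i) = set_val p (i, 1%g).
  rewrite -[in RHS](pfix (g i)).
  by change (set_val p (i, g i) = set_val p (i, (1 * g i)%g)); rewrite mul1g.
move: h1 h2; rewrite E mul1g !ltr_norml => /andP[? ?] /andP[? ?].
by apply/andP; split; lra.
Qed.

End ExtremelyAmenable.

(** * The Hilbert-Schmidt kernel of an orthogonal representation *)

Section SemiInnerProduct.
Context {R : realType} {V : lmodType R}.

Record semi_inner := SemiInner {
  ip :> V -> V -> R;
  ipC : forall x y, ip x y = ip y x;
  ip_linear : forall a x y z, ip (a *: x + y) z = a * ip x z + ip y z;
  ip_ge0 : forall x, 0 <= ip x x }.

Variable b : semi_inner.

Lemma ipDl x y z : b (x + y) z = b x z + b y z.
Proof. by rewrite -[x]scale1r ip_linear mul1r scale1r. Qed.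

Lemma ip0l z : b 0 z = 0.
Proof. by have := ipDl 0 0 z; rewrite addr0; lra. Qed.

Lemma ipZl a x z : b (a *: x) z = a * b x z.
Proof. by rewrite -[a *: x]addr0 ip_linear ip0l addr0. Qed.

Lemma ipNl x z : b (- x) z = - b x z.
Proof. by rewrite -scaleN1r ipZl mulN1r. Qed.

Lemma ipBl x y z : b (x - y) z = b x z - b y z.
Proof. by rewrite ipDl ipNl. Qed.

Lemma ipDr x y z : b z (x + y) = b z x + b z y.
Proof. by rewrite ![b z _]ipC ipDl. Qed.

Lemma ipZr a x z : b z (a *: x) = a * b z x.
Proof. by rewrite ![b z _]ipC ipZl. Qed.

Lemma ipNr x z : b z (- x) = - b z x.
Proof. by rewrite ![b z _]ipC ipNl. Qed.

Lemma ipBr x y z : b z (x - y) = b z x - b z y.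
Proof. by rewrite ipDr ipNr. Qed.

Definition ipE := (ipDl, ipDr, ipNl, ipNr, ipZl, ipZr).

Lemma ip_suml (T : Type) (r : seq T) (c : T -> R) (v : T -> V) z :
  b (\sum_(e <- r) c e *: v e) z = \sum_(e <- r) c e * b (v e) z.
Proof.
elim: r => [|e r IH]; first by rewrite !big_nil ip0l.
by rewrite !big_cons ip_linear IH.
Qed.

Lemma ip_cauchy_schwarz x y : b x y ^+ 2 <= b x x * b y y.
Proof.
have H p q : 0 <= p ^+ 2 * b x x + 2 * p * q * b x y + q ^+ 2 * b y y.
  have := ip_ge0 b (p *: x + q *: y).
  by rewrite !ipE (ipC b y x); congr (0 <= _); ring.
have x0 := ip_ge0 b x; have y0 := ip_ge0 b y.
move: H x0 y0; move: (b x x) (b y y) (b x y) => p q d H p0 q0.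
have [q00|qN0] := eqVneq q 0; last first.
  have qp : 0 < q by rewrite lt_def qN0.
  have := H q (- d).
  rewrite (_ : _ + _ = q * (p * q - d ^+ 2)); last ring.
  by rewrite pmulr_rge0// subr_ge0.
by have := H (- d) (p + 1); rewrite q00; have := sqr_ge0 d; nra.
Qed.

Lemma ip_abs_le x y : `|b x y| <= b x x + b y y.
Proof.
have hp := ip_ge0 b (x + y); have hm := ip_ge0 b (x - y).
have x0 := ip_ge0 b x; have y0 := ip_ge0 b y.
move: hp hm; rewrite !ipE (ipC b y x) ler_norml => *.
by apply/andP; split; lra.
Qed.

(* The expansion property of [es] says that it is orthonormal modulo the radical
   of [b]. *)
Lemma gram_schmidt (ys : seq V) : exists es : seq V, forall y,
  y \in ys ++ es -> forall z, b y z = \sum_(e <- es) b y e * b e z.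
Proof.
elim: ys => [|y0 ys [es esP]]; first by exists [::].
pose P := \sum_(e <- es) b y0 e *: e; pose r := y0 - P.
have re e : e \in es -> b r e = 0.
  move=> ees; rewrite ipBl ip_suml.
  have := esP e; rewrite mem_cat ees orbT => /(_ isT y0).
  rewrite (ipC b e y0) => ->; apply/eqP; rewrite subr_eq0; apply/eqP.
  by apply: eq_bigr => e' _; rewrite mulrC ![b _ e']ipC (ipC b e').
have y0E z : b y0 z = \sum_(e <- es) b y0 e * b e z + b r z.
  by rewrite ipBl ip_suml addrC subrK.
(* A residual of norm zero lies in the radical, so [es] already expands [y0]. *)
have [r0|rN0] := eqVneq (b r r) 0.
  exists es => y; rewrite inE => /predU1P[->|/esP//] z.
  suff : b r z = 0 by move=> r0'; rewrite {1}y0E r0' addr0.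
  have := ip_cauchy_schwarz r z; rewrite r0 mul0r => h.
  by apply/eqP; rewrite -sqrf_eq0 eq_le h sqr_ge0.
have rp : 0 < b r r by rewrite lt_def rN0 ip_ge0.
pose a := (Num.sqrt (b r r))^-1; pose u := a *: r.
have a2 : a ^+ 2 * b r r = 1 by rewrite exprVn sqr_sqrtr ?mulVf// ltW.
clearbody a; have ue e : e \in es -> b u e = 0 by move=> /re h; rewrite ipZl h mulr0.
have y_u y : y \in ys ++ es -> b y u = 0.
  move=> /esP ->; rewrite big1_seq// => e /andP[_ /ue].
  by rewrite (ipC b e u) => ->; rewrite mulr0.
exists (u :: es) => y.
have [old|] := boolP (y \in ys ++ es).
  move=> _ z; rewrite big_cons y_u// mul0r add0r; exact: esP.
move=> old; rewrite mem_cat !inE => h z; rewrite big_cons.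
have : (y == y0) || (y == u).
  by move: h old; rewrite mem_cat; case: (y == y0); case: (y == u); case: (y \in ys); case: (y \in es).
case/predU1P => [->|/eqP ->].
  have -> : b y0 u = a * b r r.
    rewrite y0E big1_seq ?add0r ?ipZr// => e /andP[_ /ue].
    by rewrite (ipC b e u) => ->; rewrite mulr0.
  rewrite {1}y0E [LHS]addrC (_ : b u z = a * b r z) ?ipZl//; congr (_ + _).
  by rewrite -[LHS]mul1r -a2 expr2 -!mulrA; congr (_ * _); rewrite mulrCA.
rewrite big1_seq => [|e /andP[_ /ue ->]]; last by rewrite mul0r.
by rewrite addr0 (_ : b u u = a ^+ 2 * b r r) ?a2 ?mul1r// ipZl ipZr mulrA -expr2.
Qed.

(** On pairs read as elementary tensors, this is the Hilbert-Schmidt inner product. *)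
Definition ip2 (p q : V * V) : R := b p.1 q.1 * b p.2 q.2.

Implicit Types t : seq (R * (V * V)).

Lemma gram_ip2E s t : gram ip2 s t =
  \sum_(p <- s) \sum_(q <- t) p.1 * q.1 * (b p.2.1 q.2.1 * b p.2.2 q.2.2).
Proof.
rewrite /gram /ev; apply: eq_bigr => p _; rewrite mulr_sumr.
by apply: eq_bigr => q _; rewrite mulrA.
Qed.

(** The value at [e] of the operator that the formal sum of tensors [t] represents. *)
Definition partial_ip t (e : V) : V := \sum_(p <- t) (p.1 * b p.2.2 e) *: p.2.1.

(** Parseval in the second factor: the squared Hilbert-Schmidt norm is the sum of the squared norms
    of the images of the [es]. *)
Lemma gram_ip2_expand (es : seq V) t :
  (forall p, p \in t -> forall z, b p.2.2 z = \sum_(e <- es) b p.2.2 e * b e z) ->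
  gram ip2 t t = \sum_(e <- es) b (partial_ip t e) (partial_ip t e).
Proof.
move=> esP; rewrite gram_ip2E.
have E e : b (partial_ip t e) (partial_ip t e) = \sum_(p <- t) \sum_(q <- t)
    p.1 * b p.2.2 e * (q.1 * b q.2.2 e * b q.2.1 p.2.1).
  rewrite {1}/partial_ip ip_suml; apply: eq_bigr => p _.
  by rewrite (ipC b p.2.1) /partial_ip ip_suml mulr_sumr.
under [RHS]eq_bigr do rewrite E.
rewrite [RHS]exchange_big/=; apply: eq_big_seq => p pt.
rewrite [RHS]exchange_big/=; apply: eq_bigr => q _.
rewrite (esP p pt) !mulr_sumr; apply: eq_bigr => e _.
by rewrite (ipC b e) (ipC b q.2.1); ring.
Qed.

Lemma gram_ip2_ge0 t : 0 <= gram ip2 t t.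
Proof.
have [es esP] := gram_schmidt [seq p.2.2 | p <- t].
rewrite (gram_ip2_expand (es := es)) => [|p pt].
  by apply: sumr_ge0 => e _; exact: ip_ge0.
by apply: esP; rewrite mem_cat (map_f (fun p : R * (V * V) => p.2.2) pt).
Qed.

(** Applying [A] to the first factor commutes with [partial_ip], so the bound holds term by term in
    the expansion. *)
Lemma gram_ip2_op (A : V -> V) (d : R) t : linear A ->
  (forall x, b (A x) (A x) <= d * b x x) ->
  gram ip2 [seq (p.1, (A p.2.1, p.2.2)) | p <- t]
           [seq (p.1, (A p.2.1, p.2.2)) | p <- t] <= d * gram ip2 t t.
Proof.
move=> Alin Ad; have [es esP] := gram_schmidt [seq p.2.2 | p <- t].
have A0 : A 0 = 0.
  by have := Alin 1 0 0; rewrite !scale1r addr0 => /(congr1 (fun x => x - A 0));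
    rewrite addrK subrr.
rewrite !(gram_ip2_expand (es := es)).
- rewrite mulr_sumr; apply: ler_sum => e _.
  have -> : partial_ip [seq (p.1, (A p.2.1, p.2.2)) | p <- t] e = A (partial_ip t e).
    rewrite /partial_ip big_map; elim: (t) => [|p s IH]; first by rewrite !big_nil A0.
    by rewrite !big_cons IH Alin.
  exact: Ad.
- move=> p pt; apply: esP.
  by rewrite mem_cat (map_f (fun p : R * (V * V) => p.2.2) pt).
- move=> _ /mapP[p pt ->] /=; apply: esP.
  by rewrite mem_cat (map_f (fun p : R * (V * V) => p.2.2) pt).
Qed.

Definition swapt t : seq (R * (V * V)) := [seq (p.1, (p.2.2, p.2.1)) | p <- t].

Lemma gram_swapt s t : gram ip2 (swapt s) (swapt t) = gram ip2 s t.
Proof.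
rewrite !gram_ip2E big_map; apply: eq_bigr => p _; rewrite big_map.
by apply: eq_bigr => q _ /=; rewrite [b p.2.2 _ * _]mulrC.
Qed.

Lemma gram_ip2_op2 (A : V -> V) (d : R) t : linear A ->
  (forall x, b (A x) (A x) <= d * b x x) ->
  gram ip2 [seq (p.1, (p.2.1, A p.2.2)) | p <- t]
           [seq (p.1, (p.2.1, A p.2.2)) | p <- t] <= d * gram ip2 t t.
Proof.
move=> Alin Ad; have := gram_ip2_op (swapt t) Alin Ad.
rewrite gram_swapt -[X in X <= _]gram_swapt /swapt -!map_comp.
by rewrite /comp /=.
Qed.

End SemiInnerProduct.
Arguments semi_inner {R} V.

(** * Conjugation on the Hilbert-Schmidt operators over the coboundaries *)

Section OrthogonalRepresentation.
Context {R : realType} {G : topologicalGroupType} {V : lmodType R}.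
Variables (b : semi_inner V) (pi : G -> V -> V).
Hypothesis pi_linear : forall g, linear (pi g).
Hypothesis pi1 : forall x, pi 1%g x = x.
Hypothesis piM : forall g h x, pi (g * h)%g x = pi g (pi h x).
Hypothesis pi_ip : forall g x y, b (pi g x) (pi g y) = b x y.
Hypothesis pi_uc : forall d : R, 0 < d ->
  \forall g \near (1%g : G), forall x, b (pi g x - x) (pi g x - x) <= d * b x x.

Lemma piB g x y : pi g (x - y) = pi g x - pi g y.
Proof. by rewrite addrC -scaleN1r pi_linear scaleN1r addrC. Qed.

Definition coboundary (a : G * V) : V := pi a.1 a.2 - a.2.

(** Since [pi g (pi h x - x)] is the coboundary of the pair [(g h g^-1, pi g x)], the group permutes
    the index pairs, and the results on permutation representations apply. *)
Definition conj_act (g : G) (a : G * V) : G * V := ((g * a.1 * g^-1)%g, pi g a.2).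

Lemma coboundary_conj_act g a : coboundary (conj_act g a) = pi g (coboundary a).
Proof. by rewrite /coboundary piB /= -!piM -!mulgA mulVg mulg1. Qed.

Notation Z := ((G * V) * (G * V))%type.

Definition cob2 (z : Z) : V * V := (coboundary z.1, coboundary z.2).

Definition cobt (t : seq (R * Z)) : seq (R * (V * V)) :=
  [seq (p.1, cob2 p.2) | p <- t].

Definition hs_fun (z w : Z) : R := ip2 b (cob2 z) (cob2 w).

Lemma gram_hs_fun s t : gram hs_fun s t = gram (ip2 b) (cobt s) (cobt t).
Proof.
rewrite /gram /ev big_map; apply: eq_bigr => p _; rewrite big_map.
by congr (_ * _).
Qed.

Lemma hs_funC z w : hs_fun z w = hs_fun w z.
Proof. by rewrite /hs_fun /ip2 (ipC b (cob2 w).1) (ipC b (cob2 w).2). Qed.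

Lemma hs_fun_ge0 t : 0 <= gram hs_fun t t.
Proof. by rewrite gram_hs_fun gram_ip2_ge0. Qed.

(* The reproducing kernel of the Hilbert-Schmidt operators on the closed span
   of the coboundaries. *)
Definition hs_kernel : @kernel R Z := Kernel hs_funC hs_fun_ge0.

Definition hs_act (g : G) (z : Z) : Z := (conj_act g z.1, conj_act g z.2).

Lemma conj_act1 a : conj_act 1%g a = a.
Proof. by case: a => g x; rewrite /conj_act /= mul1g invg1 mulg1 pi1. Qed.

Lemma conj_actM g h a : conj_act (g * h)%g a = conj_act g (conj_act h a).
Proof. by rewrite /conj_act /= invgM piM !mulgA. Qed.

Lemma hs_act1 z : hs_act 1%g z = z.
Proof. by case: z => a c; rewrite /hs_act !conj_act1. Qed.

Lemma hs_actM g h z : hs_act (g * h)%g z = hs_act g (hs_act h z).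
Proof. by rewrite /hs_act !conj_actM. Qed.

Lemma hs_actK g z w : hs_kernel (hs_act g z) (hs_act g w) = hs_kernel z w.
Proof.
by rewrite /hs_kernel /= /hs_fun /ip2 /= !coboundary_conj_act !pi_ip.
Qed.

Lemma pi_uc_inv (d : R) : 0 < d ->
  \forall g \near (1%g : G), forall x,
    b (pi g^-1%g x - x) (pi g^-1%g x - x) <= d * b x x.
Proof.
move=> /pi_uc; apply: filterS => g gP x.
rewrite -[X in X <= _](pi_ip g) piB -piM mulgV pi1.
have -> : x - pi g x = - (pi g x - x) by rewrite opprB.
by rewrite ipNl ipNr opprK.
Qed.

(** Conjugation moves both tensor factors. The intermediate list [s] has only the second one moved;
    each of the two steps costs a factor [d / 4], and [(p + q)^2 <= 2 p^2 + 2 q^2]. *)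
Lemma hs_translate_cont (d : R) : 0 < d ->
  \forall y \near (1%g : G), forall f : Z -> R, rkbounded hs_kernel f ->
    rknorm2 hs_kernel (translate hs_act y f - f) <= d * rknorm2 hs_kernel f.
Proof.
move=> d0; have d40 : 0 < d / 4 by rewrite divr_gt0.
apply: filterS (pi_uc_inv d40) => y yP f fb; set h := (y^-1)%g in yP.
have f0 := rknorm2_ge0 fb.
apply: rknorm2_le => [t|]; last by rewrite mulr_ge0// ltW.
pose s := [seq (p.1, (p.2.1, conj_act h p.2.2)) | p <- t].
pose A x := pi h x - x.
have Alin : linear A by move=> c x z; rewrite /A pi_linear scalerBr opprD addrACA.
(* The combinations [u - v] and [w] have the same norm once no function additive in each factor
   separates them, as the form is such a function of either argument. *)
have gram_diff (u v : seq (R * Z)) (w : seq (R * (V * V))) :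
    (forall F : V * V -> R, (forall x x' y, F (x - x', y) = F (x, y) - F (x', y)) ->
      (forall x y y', F (x, y - y') = F (x, y) - F (x, y')) ->
      ev F (cobt u) - ev F (cobt v) = ev F w) ->
    gram hs_kernel (u ++ scalet (-1) v) (u ++ scalet (-1) v) = gram (ip2 b) w w.
  move=> uvw; rewrite gram_hs_fun.
  have cat F : ev F (cobt (u ++ scalet (-1) v)) = ev F (cobt u) - ev F (cobt v).
    rewrite /cobt map_cat ev_cat; congr (_ + _).
    rewrite /scalet /ev !big_map -sumrN; apply: eq_bigr => p _ /=.
    by rewrite mulN1r mulNr.
  have lin q : ev (ip2 b q) (cobt u) - ev (ip2 b q) (cobt v) = ev (ip2 b q) w.
    by apply: uvw => *; rewrite /ip2 /= ipBr; ring.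
  rewrite {1}/gram; under eq_ev => q do rewrite cat lin.
  rewrite cat uvw// => x y' z; rewrite /ev -sumrB; apply: eq_bigr => p _;
    by rewrite /ip2 /= ipBl; ring.
have N1 : gram hs_kernel (actt hs_act h t ++ scalet (-1) s)
    (actt hs_act h t ++ scalet (-1) s) <= d / 4 * gram hs_kernel t t.
  pose w := [seq (p.1, (coboundary p.2.1, pi h (coboundary p.2.2))) | p <- t].
  rewrite (gram_diff _ _ [seq (p.1, (A p.2.1, p.2.2)) | p <- w]); last first.
    move=> F Fl Fr; rewrite /ev /cobt !big_map -sumrB; apply: eq_bigr => p _ /=.
    by rewrite /cob2 /= !coboundary_conj_act /A (Fl (pi h (coboundary p.2.1))) mulrBr.
  apply: (le_trans (gram_ip2_op w Alin yP)).
  rewrite gram_hs_fun !gram_ip2E !big_map le_eqVlt; apply/orP; left; apply/eqP.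
  congr (_ * _); apply: eq_bigr => p _; rewrite !big_map; apply: eq_bigr => q _ /=.
  by rewrite pi_ip.
have N2 : gram hs_kernel (s ++ scalet (-1) t) (s ++ scalet (-1) t) <=
    d / 4 * gram hs_kernel t t.
  rewrite (gram_diff _ _ [seq (p.1, (p.2.1, A p.2.2)) | p <- cobt t]); last first.
    move=> F Fl Fr; rewrite /ev /cobt !big_map -sumrB; apply: eq_bigr => p _ /=.
    by rewrite /cob2 /= coboundary_conj_act /A (Fr _ (pi h (coboundary p.2.2))) mulrBr.
  by apply: (le_trans (gram_ip2_op2 (cobt t) Alin yP)); rewrite gram_hs_fun.
have E : ev (translate hs_act y f - f) t =
    ev f (actt hs_act h t ++ scalet (-1) s) + ev f (s ++ scalet (-1) t).
  by rewrite evB ev_translate !ev_cat !ev_scalet; ring.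
have e1 := ev_le_rknorm2 (actt hs_act h t ++ scalet (-1) s) fb.
have e2 := ev_le_rknorm2 (s ++ scalet (-1) t) fb.
have {}e1 := le_trans e1 (ler_wpM2l f0 N1).
have {}e2 := le_trans e2 (ler_wpM2l f0 N2).
rewrite E; move: e1 e2.
move: (ev f (_ ++ scalet (-1) s)) (ev f (s ++ _)) => p q e1 e2.
have := sqr_ge0 (p - q); lra.
Qed.

Hypothesis G_ea : extremely_amenable G.

(* [b (coboundary (h, w)) (pi x y)] is the increment [f (h^-1 x) - f x] of the
   matrix coefficient [f x = b w (pi x y)]. *)
Lemma coboundary_ip_small (t : seq (G * V)) (y : V) (d : R) : 0 < d ->
  exists x, forall a, a \in t -> `|b (coboundary a) (pi x y)| < d.
Proof.
move=> d0.
pose a (i : 'I_(size t)) := tnth (in_tuple t) i.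
pose f (i : 'I_(size t)) (x : G) := b (a i).2 (pi x y).
have fb i : exists M : R, forall x, `|f i x| <= M.
  exists (b (a i).2 (a i).2 + b y y) => x.
  by rewrite (le_trans (ip_abs_le _ _ _))// pi_ip.
have fuc i (e : R) : 0 < e ->
    \forall g \near (1%g : G), forall x, `|f i (g * x)%g - f i x| <= e.
  move=> e0; pose k := b (a i).2 (a i).2 * b y y + 1.
  have k0 : 0 < k by rewrite ltr_wpDl// mulr_ge0 ?ip_ge0.
  have ek0 : 0 < e ^+ 2 / k by rewrite divr_gt0 ?exprn_gt0.
  apply: filterS (pi_uc ek0) => g gP x.
  rewrite /f piM -ipBr -ler_sqr ?nnegrE ?(ltW e0)// real_normK ?num_real//.
  apply: (le_trans (ip_cauchy_schwarz _ _ _)).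
  apply: (le_trans (ler_wpM2l (ip_ge0 b _) (gP (pi x y)))).
  rewrite pi_ip mulrCA mulrAC ler_pdivrMr// ler_wpM2l ?sqr_ge0//.
  by rewrite lerDl.
have [x xP] := ea_orbit_map fb fuc G_ea (fun i => (a i).1^-1%g) d0.
exists x => c ct; have /tnthP[i ->] : c \in in_tuple t by [].
have := xP i.
rewrite -normrN opprB /f piM -[X in _ - X](pi_ip (a i).1) -piM mulgV pi1.
rewrite -normrN opprB -ipBl; exact.
Qed.

Lemma hs_no_invariant (f : Z -> R) : rkbounded hs_kernel f ->
  (forall g, translate hs_act g f = f) -> forall z, f z = 0.
Proof.
move=> fb finv z; apply/eqP/negP => /negP fz0.
have fact g : f (hs_act g z) = f z.
  by have := congr1 (fun F => F z) (finv (g^-1)%g); rewrite /translate invgK.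
have f0 := rknorm2_ge0 fb.
set nu := rknorm2 hs_kernel f in f0.
pose k := hs_kernel z z.
have fz : 0 < f z ^+ 2 by rewrite exprn_even_gt0.
have fzk : f z ^+ 2 <= nu * k.
  have := ev_le_rknorm2 [:: (1, z)] fb.
  by rewrite gram1 /ev big_seq1 mul1r.
have k0 : 0 <= k by rewrite /k -(gram1 hs_kernel) hs_fun_ge0.
have nup : 0 < nu.
  by rewrite lt_def f0 andbT; apply/eqP => nu0; move: fzk; rewrite nu0 mul0r; lra.
(* The first bound keeps [(ev f t)^2 >= nu / 2]; the second makes the error in [close] at most
   [f z^2 nu / 16] at every translate of [z]. *)
pose eta := Num.min (nu / 2) (f z ^+ 2 / (16 * (k + 1))).
have eta0 : 0 < eta.
  by rewrite lt_min !divr_gt0//= mulr_gt0// ltr_wpDl.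
have eta1 : eta <= nu / 2 by rewrite ge_min lexx.
have eta2 : eta * (16 * k) <= f z ^+ 2.
  have h : eta <= f z ^+ 2 / (16 * (k + 1)) by rewrite ge_min lexx orbT.
  rewrite ler_pdivlMr in h; last by rewrite mulr_gt0// ltr_wpDl.
  by rewrite (le_trans _ h)// ler_wpM2l ?(ltW eta0)// ler_wpM2l// lerDl.
have [t t1 tnu] := rknorm2_adherent fb eta0; rewrite -/nu in tnu.
(* Near-maximality of [t] makes [ev f t *: f] close to [nu *: gram t]. *)
have close s : (ev f s * ev f t - nu * gram hs_kernel s t) ^+ 2 <=
    eta * (nu * gram hs_kernel s s).
  set D := (_ - _).
  have s0 : 0 <= nu * gram hs_kernel s s by rewrite mulr_ge0// hs_fun_ge0.
  have H l : 2 * l * D <= eta + l ^+ 2 * (nu * gram hs_kernel s s).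
    have := ev_le_rknorm2 (t ++ scalet l s) fb; rewrite -/nu.
    rewrite ev_cat ev_scalet !gramE (gramC hs_kernel t s).
    have := ler_wpM2l f0 t1; have := sqr_ge0 (l * ev f s).
    move: tnu; rewrite /D; nra.
  have [S0|SN0] := eqVneq (nu * gram hs_kernel s s) 0.
    have [->|D0] := eqVneq D 0; first by rewrite expr0n/= mulr_ge0// ltW.
    (* For a null [s] this [l] would give [2 eta <= eta]. *)
    have := H (eta / D); rewrite S0 mulr0 addr0 -mulrA divfK//; lra.
  have Sp : 0 < nu * gram hs_kernel s s by rewrite lt_def SN0.
  have := H (D / (nu * gram hs_kernel s s)).
  set S := nu * _ in Sp *.
  have -> : 2 * (D / S) * D = 2 * (D ^+ 2 / S) by ring.
  have -> : (D / S) ^+ 2 * S = D ^+ 2 / S.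
    rewrite exprMn exprVn -mulrA; congr (_ * _).
    by rewrite expr2 invfM -mulrA mulVf ?mulr1// gt_eqF.
  by move=> h; rewrite -ler_pdivrMr//; lra.
pose M := \sum_(p <- t) `|p.1| * (b (cob2 z).1 (cob2 z).1 + b (coboundary p.2.1) (coboundary p.2.1)).
have M0 : 0 <= M by apply: sumr_ge0 => p _; rewrite mulr_ge0// addr_ge0 ?ip_ge0.
pose eps := Num.sqrt (f z ^+ 2 * nu / 16).
have eps0 : 0 < eps by rewrite sqrtr_gt0 divr_gt0// mulr_gt0.
have de0 : 0 < eps / (nu * (M + 1)) by rewrite divr_gt0// mulr_gt0// ltr_wpDl.
(* Moving [z] by this [g] makes its second factor almost orthogonal to those of [t], while [f] keeps
   its value. *)
have [g gP] := coboundary_ip_small [seq p.2.2 | p <- t] (coboundary z.2) de0.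
have small : `|nu * gram hs_kernel [:: (1, hs_act g z)] t| <= eps.
  rewrite normrM ger0_norm// -ler_pdivlMl//.
  have -> : gram hs_kernel [:: (1, hs_act g z)] t = \sum_(p <- t) p.1 *
      (b (pi g (coboundary z.1)) (coboundary p.2.1) *
       b (coboundary p.2.2) (pi g (coboundary z.2))).
    rewrite /gram /ev big_seq1 /= mul1r; apply: eq_bigr => p _.
    by rewrite /hs_fun /ip2 /= !coboundary_conj_act (ipC b (coboundary p.2.2)).
  apply: (le_trans (ler_norm_sum _ _ _)).
  have -> : nu^-1 * eps = eps / (nu * (M + 1)) * (M + 1).
    by rewrite invfM mulrA divfK 1?mulrC// gt_eqF// ltr_wpDl.
  apply: (@le_trans _ _ (eps / (nu * (M + 1)) * M)); last first.
    by rewrite ler_wpM2l ?lerDl// ltW.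
  rewrite /M mulr_sumr big_seq [leRHS]big_seq; apply: ler_sum => p pt.
  rewrite !normrM [leRHS]mulrCA ler_wpM2l// mulrC ler_pM//.
    by apply: ltW; apply: gP; rewrite (map_f (fun p : R * Z => p.2.2) pt).
  by rewrite (le_trans (ip_abs_le _ _ _))// pi_ip.
have := close [:: (1, hs_act g z)]; rewrite gram1 hs_actK -/k /ev big_seq1 mul1r.
rewrite -/(ev f t) fact => cl.
have small2 : (nu * gram hs_kernel [:: (1, hs_act g z)] t) ^+ 2 <= f z ^+ 2 * nu / 16.
  rewrite -(@sqr_sqrtr _ (f z ^+ 2 * nu / 16)); last by rewrite divr_ge0// mulr_ge0 ?sqr_ge0.
  rewrite -[X in X <= _]real_normK ?num_real// ler_sqr ?nnegrE//; exact: ltW.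
move: cl small2; move: (nu * gram _ _ t) => h cl small2.
(* For [m = f z * ev f t], [m^2 <= 2 (m - h)^2 + 2 h^2 <= f z^2 nu / 4], against
   [m^2 >= f z^2 nu / 2 > 0]. *)
have := sqr_ge0 (f z * ev f t - 2 * h).
have : f z ^+ 2 * (nu / 2) <= (f z * ev f t) ^+ 2.
  by rewrite exprMn ler_wpM2l ?sqr_ge0//; lra.
have := ler_wpM2r f0 eta2.
have := mulr_gt0 fz nup.
move: cl small2; move: (f z * ev f t) (f z ^+ 2) => m F; lra.
Qed.

End OrthogonalRepresentation.

(** * Functions with a drift *)

Lemma cvg_sum_seq {R : realType} (S : Type) (I : eqType) (U : set_system S)
    (UF : Filter U) (s : seq I) (f : I -> S -> R) (l : I -> R) :
  (forall i, i \in s -> f i x @[x --> U] --> l i) ->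
  (\sum_(i <- s) f i x) @[x --> U] --> \sum_(i <- s) l i.
Proof.
elim: s => [|i s IH] fl.
  by rewrite big_nil; under eq_fun do rewrite big_nil; exact: cvg_cst.
rewrite big_cons; under eq_fun do rewrite big_cons.
apply: cvgD; first by apply: fl; exact: mem_head.
by apply: IH => j js; apply: fl; rewrite inE js orbT.
Qed.

Lemma fmap_ultra (S T : Type) (h : S -> T) (U : set_system S) :
  UltraFilter U -> UltraFilter (h @ U).
Proof.
move=> UU; split; first exact: fmap_proper_filter.
move=> W WF UW; rewrite eqEsubset; split=> // A WA.
have [//|hA] := in_ultra_setVsetC (h @^-1` A) UU.
have WnA : W (~` A) by exact: UW.
by have [x []] := filter_ex (filterI WA WnA).
Qed.

Section Drift.
Context {R : realType} {G : topologicalGroupType}.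

(** Along such an ultrafilter almost every [E] contains a given [x], so a closed condition known for
    [x] in [E] holds at every [x] in the limit. *)
Lemma seq_ultrafilter : exists U : set_system (seq G),
  UltraFilter U /\ forall x : G, U [set E : seq G | x \in E].
Proof.
pose F : set_system (seq G) :=
  [set A | exists E0 : seq G, [set E : seq G | {subset E0 <= E}] `<=` A].
have FF : ProperFilter F.
  split; first by move=> [E0 E00]; exact: (E00 E0).
  split.
  - by exists [::].
  - move=> A B [EA hA] [EB hB]; exists (EA ++ EB) => E sE; split.
      by apply: hA => x xA; apply: sE; rewrite mem_cat xA.
    by apply: hB => x xB; apply: sE; rewrite mem_cat xB orbT.
  - by move=> A B AB [E0 hE]; exists E0; exact: subset_trans hE AB.
have [U [UU FU]] := ultraFilterLemma FF.
exists U; split => // x; apply: FU; exists [:: x] => E; apply.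
by rewrite mem_head.
Qed.

Variable L : seq G.
Hypothesis L_gt0 : (0 < size L)%N.
Hypothesis L_inv : perm_eq [seq g^-1%g | g <- L] L.

Variable F : seq G -> G -> G -> R.
Variable k : R.
Hypothesis F_bounded : forall E g x, g \in L -> `|F E g x| <= k.
Hypothesis F_uc : forall d : R, 0 < d -> \forall y \near (1%g : G),
  forall E g x, g \in L -> `|F E g (y * x)%g - F E g x| <= d.
Hypothesis F_inv : forall E g x, F E g^-1%g x = - F E g (g^-1 * x)%g.
Hypothesis F_drift : forall E x, x \in E ->
  \sum_(g <- L) F E g x <= - ((size L)%:R / 4).

(* The limit of the [F E] along an ultrafilter is a family to which
   [ea_orbit_map] applies; by [F_inv] its sum over [L] nearly vanishes at some
   point, against [F_drift]. *)
Lemma ea_no_drift : ~ extremely_amenable G.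
Proof.
move=> ea; have [U [UU Ux]] := seq_ultrafilter.
have LV g : g \in L -> (g^-1)%g \in L.
  by move=> gL; rewrite -(perm_mem L_inv) map_f.
have Fcvg g x : g \in L -> exists l : R, F E g x @[E --> U] --> l.
  move=> gL; have := @segment_compact R (- k) k; rewrite compact_ultra.
  move=> /(_ _ (@fmap_ultra _ _ (fun E => F E g x) _ UU))[].
    by apply: (@filterS _ U _ setT) => [E _|]; [
      rewrite /= in_itv/= -ler_norml F_bounded|exact: filterT].
  by move=> l [_ h]; exists l.
pose f g x : R := lim (F E g x @[E --> U]).
have fE g x : g \in L -> F E g x @[E --> U] --> f g x.
  by move=> /(Fcvg _ x) /cvg_ex.
have f_inv g x : g \in L -> f g^-1%g x = - f g (g^-1 * x)%g.
  move=> gL; apply: cvg_lim => //; under eq_fun do rewrite F_inv.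
  by apply: cvgN; exact: fE.
have f_drift x : \sum_(g <- L) f g x <= - ((size L)%:R / 4).
  have h : (\sum_(g <- L) F E g x) @[E --> U] --> \sum_(g <- L) f g x.
    by apply: (@cvg_sum_seq _ _ _ U _ L (fun g E => F E g x)) => g; exact: fE.
  rewrite -(cvg_lim _ h)//; apply: limr_le; first by apply/cvg_ex; eexists; exact: h.
  by apply: filterS (Ux x) => E; exact: F_drift.
have f_close g x y (d : R) : g \in L -> (forall E, `|F E g y - F E g x| <= d) -> `|f g y - f g x| <= d.
  move=> gL h; have c : `|F E g y - F E g x| @[E --> U] --> `|f g y - f g x|.
    by apply: cvg_norm; apply: cvgB; exact: fE.
  rewrite -(cvg_lim _ c)//; apply: limr_le; first by apply/cvg_ex; eexists; exact: c.
  by apply: (@filterS _ U _ setT) => [E _|]; [|exact: filterT]; exact: h.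
pose gL (i : 'I_(size L)) := tnth (in_tuple L) i.
have gLP i : gL i \in L by exact: mem_tnth.
have fb i : exists M : R, forall x, `|f (gL i) x| <= M.
  exists k => x; have c : `|F E (gL i) x| @[E --> U] --> `|f (gL i) x|.
    by apply: cvg_norm; exact: fE.
  rewrite -(cvg_lim _ c)//; apply: limr_le; first by apply/cvg_ex; eexists; exact: c.
  by apply: (@filterS _ U _ setT) => [E _|]; [|exact: filterT]; exact: F_bounded.
have fuc i (d : R) : 0 < d ->
    \forall y \near (1%g : G), forall x, `|f (gL i) (y * x)%g - f (gL i) x| <= d.
  move=> /F_uc; apply: filterS => y yP x.
  by apply: f_close => // E; exact: yP.
have d0 : 0 < 1 / 4 :> R by rewrite divr_gt0.
have [x xP] := ea_orbit_map fb fuc ea (fun i => (gL i)^-1%g) d0.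
have xL g : g \in L -> f g x - f g (g^-1 * x)%g >= - (1 / 4).
  move=> gLL; have /tnthP[i gi] : g \in in_tuple L by [].
  by have := xP i; rewrite /gL -gi ltr_norml => /andP[_ h]; lra.
(* By [f_inv] and the symmetry of [L], twice the sum of the [f g x] is a sum of differences, each at
   least [- 1/4] by [xL]; the drift would make it at most [- 1/2] times the size of [L]. *)
have h1 : \sum_(g <- L) f g x = \sum_(g <- L) - f g (g^-1 * x)%g.
  rewrite -(perm_big _ L_inv) big_map big_seq [RHS]big_seq.
  by apply: eq_bigr => g gLL; exact: f_inv.
have h2 : \sum_(g <- L) - (1 / 4) <= \sum_(g <- L) (f g x - f g (g^-1 * x)%g).
  by rewrite big_seq [leRHS]big_seq; apply: ler_sum.
have h3 : 0 < (size L)%:R :> R by rewrite ltr0n.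
move: h2; rewrite big_split/= -h1 big_const_seq count_predT iter_addr addr0.
rewrite -mulr_natr; have := f_drift x; lra.
Qed.

End Drift.

(** * Superharmonic quadratic forms *)

Section QuadraticForms.
Context {R : realType} {V : lmodType R} (b : semi_inner V).
Implicit Types q c : V -> R.

Definition quadratic q := forall x y, q (x + y) + q (x - y) = 2 * q x + 2 * q y.

Lemma quadratic_ip : quadratic (fun x => b x x).
Proof. by move=> x y; rewrite !ipE (ipC b y x); lra. Qed.

Lemma quadratic0 q : quadratic q -> q 0 = 0.
Proof. by move=> qq; have := qq 0 0; rewrite subr0 addr0; lra. Qed.

(** The difference is four times the polar form of [c], which is additive in [y]. The induction
    carries two consecutive values because the parallelogram law links three. *)
Lemma quadratic_diffMn c x y n : quadratic c ->
  c (x + y *+ n) - c (x - y *+ n) = n%:R * (c (x + y) - c (x - y)).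
Proof.
move=> cq; suff : c (x + y *+ n) - c (x - y *+ n) = n%:R * (c (x + y) - c (x - y)) /\
    c (x + y *+ n.+1) - c (x - y *+ n.+1) = n.+1%:R * (c (x + y) - c (x - y)) by case.
elim: n => [|n [IH1 IH2]].
  by rewrite !mulr0n !mulr1n addr0 subr0 subrr mul0r mul1r.
split=> //.
have hp := cq (x + y *+ n.+1) y; have hm := cq (x - y *+ n.+1) (- y).
have e1 : x + y *+ n.+1 + y = x + y *+ n.+2 by rewrite -addrA -mulrSr.
have e2 : x + y *+ n.+1 - y = x + y *+ n by rewrite mulrSr addrA addrK.
have e3 : x - y *+ n.+1 - y = x - y *+ n.+2 by rewrite -addrA -opprD -mulrSr.
have e4 : x - y *+ n.+1 - - y = x - y *+ n.
  by rewrite opprK mulrSr opprD addrA subrK.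
have cN : c (- y) = c y.
  by have := cq 0 y; rewrite add0r sub0r (quadratic0 cq); lra.
move: hp hm; rewrite e1 e2 e3 e4 cN.
move: IH1 IH2; rewrite -[n.+2]addn2 -[n.+1]addn1 !natrD; nra.
Qed.

(** With [x] the midpoint and [y] half the difference of [u] and [v], [n (c u - c v)] is the
    difference of [c] at [x + n y] and [x - n y]. It is at most [4 k] once [n y] has norm at most 1,
    whatever [c] is. *)
Lemma quadratic_equicont (k d : R) : 0 < d -> exists2 e, 0 < e &
  forall c u v, quadratic c -> (forall x, `|c x| <= k * b x x) ->
    b u u = 1 -> b v v = 1 -> b (u - v) (u - v) <= e -> `|c u - c v| <= d.
Proof.
move=> d0; pose n := (Num.truncn (4 * k / d)).+1.
have n0 : 0 < n%:R :> R by rewrite ltr0n.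
have kn : 4 * k <= d * n%:R.
  by rewrite -ler_pdivrMl// mulrC ltW// Num.Theory.truncnS_gt.
exists (n%:R ^+ 2)^-1; first by rewrite invr_gt0 exprn_gt0.
move=> c u v cq ck u1 v1 uv.
pose x := (1 / 2 : R) *: (u + v); pose y := (1 / 2 : R) *: (u - v).
have half w : (1 / 2 : R) *: (w + w) = w.
  by rewrite scalerDr -scalerDl (_ : _ + _ = 1) ?scale1r//; lra.
have xu : x + y = u by rewrite /x /y -scalerDr addrACA subrr addr0 half.
have xv : x - y = v.
  by rewrite /x /y -scalerBr opprB [v - u]addrC addrACA subrr add0r half.
have k0 : 0 <= k by have := le_trans (normr_ge0 _) (ck u); rewrite u1 mulr1.
have x1 : b x x <= 1.
  have := quadratic_ip x y; rewrite /= xu xv u1 v1; have := ip_ge0 b y; lra.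
have y1 : b y y * n%:R ^+ 2 <= 1.
  rewrite /y !ipE -ler_pdivlMr ?exprn_gt0// mul1r.
  by have := ip_ge0 b (u - v); rewrite !ipE in uv *; move: uv; lra.
have D := quadratic_diffMn x y n cq; rewrite xu xv in D.
have Q := quadratic_ip x (y *+ n); rewrite /= in Q.
have yn : b (y *+ n) (y *+ n) = b y y * n%:R ^+ 2.
  by rewrite -scaler_nat ipZl ipZr; ring.
have h1 := ck (x + y *+ n); have h2 := ck (x - y *+ n).
have h3 := ler_normB (c (x + y *+ n)) (c (x - y *+ n)).
rewrite D normrM ger0_norm ?ler0n// in h3.
have h4 : k * b (x + y *+ n) (x + y *+ n) + k * b (x - y *+ n) (x - y *+ n) <= k * 4.
  by rewrite -mulrDr Q yn ler_wpM2l//; lra.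
rewrite -(ler_pM2l n0); lra.
Qed.

(* Moreau envelope of [a q]. It stays a quadratic form, while depending on [q]
   in a monotone and concave way. *)
Definition envelope q (a : R) (x : V) : R :=
  inf [set a * q y + b (x - y) (x - y) | y in [set: V]].

Section Envelope.
Variable q : V -> R.
Hypothesis q_ge0 : forall x, 0 <= q x.
Hypothesis q_quadratic : quadratic q.

Lemma envelope_le a x y : 0 <= a -> envelope q a x <= a * q y + b (x - y) (x - y).
Proof.
move=> a0; apply: ge_inf; last by exists y.
by exists 0 => _ [z _ <-]; rewrite addr_ge0 ?mulr_ge0// ip_ge0.
Qed.

Lemma le_envelope a x m : (forall y, m <= a * q y + b (x - y) (x - y)) ->
  m <= envelope q a x.
Proof.
move=> h; apply: lb_le_inf => [|_ [z _ <-]]; last exact: h.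
by exists (a * q 0 + b (x - 0) (x - 0)), 0.
Qed.

Lemma envelope_ge0 a x : 0 <= a -> 0 <= envelope q a x.
Proof.
by move=> a0; apply: le_envelope => y; rewrite addr_ge0 ?mulr_ge0// ip_ge0.
Qed.

Lemma envelope_le_ip a x : 0 <= a -> envelope q a x <= b x x.
Proof.
move=> a0; apply: le_trans (envelope_le x 0 a0) _.
by rewrite (quadratic0 q_quadratic) mulr0 add0r subr0.
Qed.

Lemma envelope_le_q a x : 0 <= a -> envelope q a x <= a * q x.
Proof.
by move=> a0; apply: le_trans (envelope_le x x a0) _; rewrite subrr ip0l addr0.
Qed.

(** One inequality comes from testing the infima at [x' + y'] and [x' - y']. The reverse one is its
    instance at [x + y] and [x - y], combined with [dbl], where the test vector is halved. *)
Lemma envelope_quadratic a : 0 <= a -> quadratic (envelope q a).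
Proof.
move=> a0.
have le x y : envelope q a (x + y) + envelope q a (x - y) <=
    2 * envelope q a x + 2 * envelope q a y.
  rewrite -lerBlDr -ler_pdivrMl ?invr_gt0//.
  apply: le_envelope => x'; rewrite ler_pdivrMl// lerBlDr -lerBlDl -ler_pdivrMl//.
  apply: le_envelope => y'; rewrite ler_pdivrMl// lerBlDl.
  have h1 := envelope_le (x + y) (x' + y') a0.
  have h2 := envelope_le (x - y) (x' - y') a0.
  have A1 : x + y - (x' + y') = (x - x') + (y - y') by rewrite opprD addrACA.
  have A2 : x - y - (x' - y') = (x - x') - (y - y').
    by rewrite opprD addrACA -opprD.
  have := quadratic_ip (x - x') (y - y'); have := q_quadratic x' y'.
  move: h1 h2; rewrite A1 A2 /=; nra.
have dbl x : 4 * envelope q a x <= envelope q a (x + x).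
  apply: le_envelope => y; pose h := (1 / 2 : R) *: y.
  have yh : y = h + h by rewrite -scalerDl (_ : _ + _ = 1) ?scale1r//; lra.
  have h1 := envelope_le x h a0; rewrite yh opprD addrACA.
  have := quadratic_ip (x - h) (x - h); have := q_quadratic h h.
  by rewrite /= !subrr (quadratic0 q_quadratic) ip0l; nra.
move=> x y; apply/eqP; rewrite eq_le le/=.
have := le (x + y) (x - y); rewrite addrACA subrr addr0.
rewrite (_ : x + y - (x - y) = y + y); last by rewrite opprB addrC addrA subrK.
by have := dbl x; have := dbl y; lra.
Qed.

Lemma envelope_mono a a' x : 0 <= a -> a <= a' -> envelope q a x <= envelope q a' x.
Proof.
move=> a0 aa'; apply: le_envelope => y.
by apply: le_trans (envelope_le x y a0) _; rewrite lerD2r ler_wpM2r.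
Qed.

End Envelope.
End QuadraticForms.

(** * The drift of the envelopes of superharmonic forms *)

Section SuperharmonicForms.
Context {R : realType} {G : topologicalGroupType} {V : lmodType R}.
Variables (b : semi_inner V) (pi : G -> V -> V).
Hypothesis pi_linear : forall g, linear (pi g).
Hypothesis pi1 : forall x, pi 1%g x = x.
Hypothesis piM : forall g h x, pi (g * h)%g x = pi g (pi h x).
Hypothesis pi_ip : forall g x y, b (pi g x) (pi g y) = b x y.
Hypothesis pi_uc : forall d : R, 0 < d ->
  \forall g \near (1%g : G), forall x, b (pi g x - x) (pi g x - x) <= d * b x x.
Variable L : seq G.
Hypothesis L_gt0 : (0 < size L)%N.
Hypothesis L_inv : perm_eq [seq g^-1%g | g <- L] L.
Notation n := ((size L)%:R : R).
Variable r : R.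
Hypothesis r_gt0 : 0 < r.
Hypothesis r_lt : r < n.

Let n_gt0 : 0 < n. Proof. by rewrite ltr0n. Qed.

Definition superharmonic (q : V -> R) :=
  forall x, \sum_(g <- L) q (pi g x) <= r * q x.

Lemma pi_D g x y : pi g (x + y) = pi g x + pi g y.
Proof. by rewrite -[x]scale1r pi_linear !scale1r. Qed.

Lemma ip_piB g x y : b (pi g x - pi g y) (pi g x - pi g y) = b (x - y) (x - y).
Proof. by rewrite -(piB pi_linear) pi_ip. Qed.

Section OneForm.
Variable q : V -> R.
Hypothesis q_ge0 : forall x, 0 <= q x.
Hypothesis q_quadratic : quadratic q.
Hypothesis q_sh : superharmonic q.

(** Testing the envelope at [pi g x] with [pi g y] leaves the distance term unchanged, while the
    values of [q] sum to at most [r q y], that is [n] times [(r / n) q y]. *)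
Lemma envelope_sum a x : 0 <= a ->
  \sum_(g <- L) envelope b q a (pi g x) <= n * envelope b q (a * (r / n)) x.
Proof.
move=> a0; rewrite -ler_pdivrMl//; apply: le_envelope => y; rewrite ler_pdivrMl//.
apply: (@le_trans _ _ (\sum_(g <- L) (a * q (pi g y) + b (x - y) (x - y)))).
  by apply: ler_sum => g _; rewrite -(ip_piB g); exact: envelope_le.
rewrite big_split/= -mulr_sumr big_const_seq count_predT iter_addr addr0.
rewrite mulrDr mulrA lerD ?mulr_natl//.
apply: (le_trans (ler_wpM2l a0 (q_sh y))).
by rewrite mulrA le_eqVlt; apply/orP; left; apply/eqP; field; rewrite gt_eqF.
Qed.

Lemma envelope_translate a g x : 0 <= a -> g \in L ->
  envelope b q a (pi g x) <= envelope b q (a * r) x.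
Proof.
move=> a0 gL; apply: le_envelope => y.
apply: le_trans (envelope_le b q_ge0 (pi g x) (pi g y) a0) _.
rewrite ip_piB lerD2r -mulrA ler_wpM2l//.
apply: le_trans (q_sh y); rewrite (big_rem g gL)/= lerDl.
by apply: sumr_ge0.
Qed.

Let rho := r / n.
Let rho_ge0 : 0 <= rho. Proof. by rewrite divr_ge0// ltW. Qed.

(* Up to a bounded error, [- log rho] times this sum plays the part of the
   quadratic form of the logarithm of [q]. *)
Definition envelope_series m x := \sum_(j < m) envelope b q (rho ^+ j) x.

Lemma envelope_series_quadratic m : quadratic (envelope_series m).
Proof.
move=> x y; rewrite /envelope_series !mulr_sumr -!big_split/=.
apply: eq_bigr => j _; apply: envelope_quadratic => //; exact: exprn_ge0.
Qed.

(** Averaging replaces the parameter [rho^j] by [rho^(j+1)], so the series telescopes. *)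
Lemma envelope_series_sum m x : \sum_(g <- L) envelope_series m (pi g x) <=
  n * (envelope_series m x - envelope b q 1 x + envelope b q (rho ^+ m) x).
Proof.
have -> : envelope_series m x - envelope b q 1 x + envelope b q (rho ^+ m) x =
    \sum_(j < m) envelope b q (rho ^+ j.+1) x.
  rewrite addrAC; apply/eqP; rewrite subr_eq; apply/eqP.
  rewrite /envelope_series -(big_ord_recr m (fun j => envelope b q (rho ^+ j) x)) big_ord_recl /=.
  by rewrite expr0 addrC.
rewrite /envelope_series exchange_big/= mulr_sumr; apply: ler_sum => j _.
by rewrite exprSr; apply: envelope_sum; exact: exprn_ge0.
Qed.

(** One translation multiplies the parameter by at most [r], which a shift by [k] indices absorbs.
    The [k] leading envelopes are at most [b x x] each, and the bound is uniform in [m]. *)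
Lemma envelope_series_translate k m g x : rho ^+ k * r <= 1 -> g \in L ->
  envelope_series m (pi g x) <= k%:R * b x x + envelope_series m x.
Proof.
move=> kr gL; have e0 j y : 0 <= envelope b q (rho ^+ j) y.
  by apply: envelope_ge0 => //; exact: exprn_ge0.
apply: (@le_trans _ _ (envelope_series (k + m) (pi g x))).
  by rewrite /envelope_series addnC big_split_ord/= lerDl sumr_ge0.
rewrite /envelope_series big_split_ord/= lerD//.
  rewrite mulr_natl -[k in leRHS]card_ord -sumr_const; apply: ler_sum => j _.
  by rewrite -(pi_ip g); apply: envelope_le_ip => //; exact: exprn_ge0.
apply: ler_sum => j _; apply: le_trans (envelope_translate _ _ gL) _.
  exact: exprn_ge0.
apply: envelope_mono => //; first by rewrite mulr_ge0 ?exprn_ge0// ltW.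
by rewrite exprD mulrAC ler_piMl// exprn_ge0.
Qed.

End OneForm.

Variable e0 : V.
Hypothesis e0_unit : b e0 e0 = 1.
Variables (q : G -> V -> R) (C : R).
Hypothesis q_ge0 : forall z x, 0 <= q z x.
Hypothesis q_quadratic : forall z, quadratic (q z).
Hypothesis q_sh : forall z, superharmonic (q z).
Hypothesis q_ge : forall z x, b (pi z e0) x ^+ 2 <= q z x.
Hypothesis q_le : forall z x, q z x <= C * b x x.

(** The forms [q z] are summed over [z] in [E]. The upper bound of the sum grows with [E], but it
    enters only the truncation index [m E]; the increments [dc] stay bounded by [k], hence
    equicontinuous on the sphere, for all [E]. *)
Lemma superharmonic_not_ea : ~ extremely_amenable G.
Proof.
pose rho := r / n.
have rho0 : 0 < rho by rewrite divr_gt0.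
have rho1 : rho < 1 by rewrite ltr_pdivrMr// mul1r.
have rho_small (d : R) : 0 < d -> exists m, rho ^+ m < d.
  move=> d0; have := cvg_expr (_ : `|rho| < 1); rewrite ger0_norm ?(ltW rho0)//.
  move=> /(_ rho1) /cvgrPdist_lt /(_ d d0) [m _ /(_ m (leqnn m))] /=.
  by rewrite sub0r normrN ger0_norm ?exprn_ge0 ?(ltW rho0)//; exists m.
have [k kr] : exists k, rho ^+ k * r <= 1.
  have [k kr] := rho_small r^-1 (ltac:(by rewrite invr_gt0)).
  by exists k; rewrite -ler_pdivlMr// div1r ltW.
pose qE (E : seq G) x := \sum_(z <- E) q z x.
have qE0 E x : 0 <= qE E x by apply: sumr_ge0.
have qEq E : quadratic (qE E).
  move=> x y; rewrite /qE !mulr_sumr -!big_split/=.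
  by apply: eq_bigr => z _; exact: q_quadratic.
have qEsh E : superharmonic (qE E).
  by move=> x; rewrite /qE exchange_big/= mulr_sumr; apply: ler_sum => z _; exact: q_sh.
have qEle E x : qE E x <= (size E)%:R * C * b x x.
  apply: (le_trans (ler_sum _ (fun z _ => q_le z x))).
  by rewrite big_const_seq count_predT iter_addr addr0 -mulrA mulr_natl.
have C0 : 0 <= C by rewrite -[C]mulr1 -e0_unit (le_trans _ (q_le 1%g e0)).
(* Truncating there makes the last envelope at most [1/4] on the unit sphere. *)
have mP (E : seq G) : exists m, rho ^+ m * ((size E)%:R * C) <= 1 / 4.
  have K0 : 0 <= (size E)%:R * C by rewrite mulr_ge0.
  have K1 : 0 < (size E)%:R * C + 1 by rewrite ltr_wpDl.
  have [m mK] := rho_small (1 / 4 / ((size E)%:R * C + 1)) (ltac:(by rewrite !divr_gt0)).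
  exists m; rewrite ltr_pdivlMr// in mK; apply: le_trans (ltW mK).
  by rewrite ler_wpM2l ?lerDl// exprn_ge0// ltW.
pose m E := projT1 (cid (mP E)).
have mE E : rho ^+ m E * ((size E)%:R * C) <= 1 / 4 by exact: (projT2 (cid (mP E))).
pose c E := envelope_series (qE E) (m E).
have cq E : quadratic (c E) by apply: envelope_series_quadratic.
pose dc E g x := c E (pi g x) - c E x.
have dcq E g : quadratic (dc E g).
  move=> x y; rewrite /dc pi_D (piB pi_linear).
  have := cq E x y; have := cq E (pi g x) (pi g y); lra.
have LV g : g \in L -> (g^-1)%g \in L.
  by move=> gL; rewrite -(perm_mem L_inv) map_f.
have dck E g x : g \in L -> `|dc E g x| <= k%:R * b x x.
  move=> gL.
  have h1 := envelope_series_translate (qE0 E) (qEq E) (qEsh E) (m E) x kr gL.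
  have h2 := envelope_series_translate (qE0 E) (qEq E) (qEsh E) (m E) (pi g x) kr (LV _ gL).
  rewrite -piM mulVg pi1 pi_ip in h2.
  by rewrite ler_norml /dc /c; apply/andP; split; lra.
pose F E g x := dc E g (pi x e0).
apply: (@ea_no_drift R G L L_gt0 L_inv F k%:R).
- by move=> E g x gL; have := dck E g (pi x e0) gL; rewrite pi_ip e0_unit mulr1.
- move=> d d0; have [e e_gt0 eP] := quadratic_equicont b k%:R d0.
  apply: filterS (pi_uc e_gt0) => y yP E g x gL.
  apply: eP => //; first by move=> z; exact: dck.
  + by rewrite pi_ip.
  + by rewrite pi_ip.
  + by rewrite piM; have := yP (pi x e0); rewrite pi_ip e0_unit mulr1.
- by move=> E g x; rewrite /F /dc !piM -(piM g) mulgV pi1 opprB.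
- move=> E x xE; set v := pi x e0.
  have v1 : b v v = 1 by rewrite pi_ip.
  have h1 := envelope_series_sum (qE0 E) (qEsh E) (m E) v.
  (* With [t = b v y], [qE E y >= t^2], [|v - y|^2 >= (1 - t)^2] and [t^2 + (1 - t)^2 >= 1/2]. *)
  have h2 : 1 / 2 <= envelope b (qE E) 1 v.
    apply: le_envelope => y; rewrite mul1r.
    have hq : b v y ^+ 2 <= qE E y.
      apply: (le_trans (q_ge x y)); rewrite /qE (big_rem x xE)/= lerDl.
      by apply: sumr_ge0.
    have := ip_cauchy_schwarz b v (v - y); rewrite v1 mul1r (ipBr b v y v) v1 => hc.
    by have := sqr_ge0 (b v y - 1 / 2); nra.
  have h3 : envelope b (qE E) (rho ^+ m E) v <= 1 / 4.
    apply: le_trans (envelope_le_q b (qE0 E) v (exprn_ge0 _ (ltW rho0))) _.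
    apply: le_trans (mE E); rewrite ler_wpM2l ?exprn_ge0 ?(ltW rho0)//.
    by rewrite (le_trans (qEle E v))// v1 mulr1.
  rewrite /F /dc big_split/= sumrN big_const_seq count_predT iter_addr addr0 -mulr_natl.
  rewrite -/v; move: h1; rewrite -/rho -/(c E) => h1.
  have : n * (c E v - envelope b (qE E) 1 v + envelope b (qE E) (rho ^+ m E) v) <=
      n * (c E v - 1 / 4) by rewrite ler_pM2l//; lra.
  move: h1; rewrite /c; lra.
Qed.

End SuperharmonicForms.

(** * Green forms *)

Section Contraction.
Context {R : realType} {G : topologicalGroupType} {Z : Type}.
Variables (K : @kernel R Z) (act : G -> Z -> Z).
Hypothesis act1 : forall z, act 1%g z = z.
Hypothesis actM : forall g h z, act (g * h)%g z = act g (act h z).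
Hypothesis actK : forall g z w, K (act g z) (act g w) = K z w.

Definition rkn (f : Z -> R) : R := Num.sqrt (rknorm2 K f).

Lemma rkn_triangle f h : rkbounded K f -> rkbounded K h ->
  rkn (f + h) <= rkn f + rkn h.
Proof.
move=> fb hb; have f0 := rknorm2_ge0 fb; have h0 := rknorm2_ge0 hb.
rewrite -ler_sqr ?nnegrE ?sqrtr_ge0 ?addr_ge0 ?sqrtr_ge0//.
rewrite sqrrD !sqr_sqrtr// ?rknorm2_ge0//; last exact: rkboundedD.
rewrite rknorm2D// -mulr_natl -sqrtrM//.
have : rkdot K f h <= Num.sqrt (rknorm2 K f * rknorm2 K h).
  by rewrite (le_trans (ler_norm _))// -sqrtr_sqr ler_wsqrtr// rkdot_cauchy_schwarz.
lra.
Qed.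

Definition sum_translate (L : seq G) (f : Z -> R) : Z -> R :=
  \sum_(g <- L) translate act g f.

Lemma sum_translate_bounded L f : rkbounded K f -> rkbounded K (sum_translate L f).
Proof.
move=> fb; rewrite /sum_translate; elim: L => [|g L IH].
  by rewrite big_nil; exact: rkbounded0.
by rewrite big_cons; apply: rkboundedD => //; exact: rkbounded_translate.
Qed.

Lemma rkn_translate g f : rkbounded K f -> rkn (translate act g f) = rkn f.
Proof. by move=> fb; rewrite /rkn rknorm2_translate. Qed.

Lemma rkn_sum_translate L f : rkbounded K f ->
  rkn (sum_translate L f) <= (size L)%:R * rkn f.
Proof.
move=> fb; rewrite /sum_translate; elim: L => [|g L IH].
  by rewrite big_nil mul0r /rkn -(scale0r f) rknorm2Z// expr0n mul0r sqrtr0.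
rewrite big_cons; have gb := rkbounded_translate actK g fb.
apply: (le_trans (rkn_triangle gb (sum_translate_bounded L fb))).
by rewrite rkn_translate// -[size (g :: L)]/(size L).+1 -natr1 mulrDl mul1r addrC lerD2r.
Qed.

Definition symmetrize (L : seq G) := 1%g :: L ++ [seq g^-1%g | g <- L].

Lemma symmetrize_inv L : perm_eq [seq g^-1%g | g <- symmetrize L] (symmetrize L).
Proof.
have E : [seq g^-1%g | g <- [seq g^-1%g | g <- L]] = L.
  by rewrite -map_comp -[RHS]map_id; apply: eq_map => g /=; rewrite invgK.
rewrite /symmetrize /= invg1 perm_cons map_cat E.
by move: [seq _ | _ <- _] => s; rewrite perm_catC.
Qed.

(* The vectors [f] and [translate g f] have the same norm and are far apart, so
   their sum is shorter than [2 f]. *)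
Lemma sum_translate_contraction (c : R) (L0 : seq G) : 0 < c ->
  (forall f, rkbounded K f -> exists2 g, g \in L0 &
     c * rknorm2 K f <= rknorm2 K (translate act g f - f)) ->
  let L := symmetrize L0 in
  exists r, [/\ 0 <= r, r < (size L)%:R & forall f, rkbounded K f ->
     rkn (sum_translate L f) <= r * rkn f].
Proof.
move=> c0 gap L.
have s4 : Num.sqrt (4 - c) < 2.
  have -> : 2 = Num.sqrt (2 ^+ 2) :> R by rewrite sqrtr_sqr ger0_norm.
  by rewrite ltr_sqrt ?exprn_gt0//; lra.
have s0 := sqrtr_ge0 (4 - c).
have [g0 g0L _] := gap 0 (rkbounded0 K).
have sz : (2 <= size L)%N by rewrite /L /= size_cat; case: (L0) g0L.
have szE : (size L)%:R = (size L - 2)%:R + 2 :> R by rewrite -natrD subnK.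
(* The parallelogram law gives [|f + gf|^2 = 4 |f|^2 - |gf - f|^2 <= (4 - c) |f|^2]; the triangle
   inequality bounds the other [size L - 2] translates. *)
exists ((size L - 2)%:R + Num.sqrt (4 - c)); split.
- by rewrite addr_ge0.
- by rewrite szE ltrD2l.
move=> f fb; have [g gL0 fg] := gap f fb; have f0 := rknorm2_ge0 fb.
pose rest := rem g L0 ++ [seq g^-1%g | g <- L0].
have LE : perm_eq L (1%g :: g :: rest).
  by rewrite /L /symmetrize perm_cons -cat_cons perm_cat2r perm_to_rem.
have szr : size rest = (size L - 2)%N by rewrite (perm_size LE) /= subn2.
have gb := rkbounded_translate actK g fb.
rewrite /sum_translate (perm_big _ LE)/= !big_cons translate1// addrA.
apply: (le_trans (rkn_triangle (rkboundedD fb gb) (sum_translate_bounded rest fb))).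
rewrite addrC mulrDl lerD//; first by rewrite -szr rkn_sum_translate.
rewrite mulrC -sqrtrM//; apply: ler_wsqrtr.
have := rknorm2_parallelogram fb gb; have := rknorm2N (rkboundedB gb fb).
rewrite opprB rknorm2_translate// => ->; lra.
Qed.

Lemma iter_sum_translate L m f : rkbounded K f ->
  rkbounded K (iter m (sum_translate L) f).
Proof. by move=> fb; elim: m => //= m; exact: sum_translate_bounded. Qed.

Lemma iter_sum_translate_le L (r : R) m f : 0 <= r ->
  (forall f, rkbounded K f -> rkn (sum_translate L f) <= r * rkn f) ->
  rkbounded K f -> rkn (iter m (sum_translate L) f) <= r ^+ m * rkn f.
Proof.
move=> r0 rP fb; elim: m => [|m IH]; first by rewrite mul1r.
rewrite iterS (le_trans (rP _ (iter_sum_translate _ _ fb)))//.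
by rewrite exprS -mulrA ler_wpM2l.
Qed.

Lemma sum_translate_sum L (s : seq G) (F : G -> Z -> R) :
  sum_translate L (\sum_(g <- s) F g) = \sum_(g <- s) sum_translate L (F g).
Proof.
rewrite /sum_translate exchange_big/=; apply: eq_bigr => g _.
elim: s => [|h s IH]; first by rewrite !big_nil.
by rewrite !big_cons -IH.
Qed.

Lemma iter_sum_translate_sum L m (s : seq G) (F : G -> Z -> R) :
  iter m (sum_translate L) (\sum_(g <- s) F g) =
  \sum_(g <- s) iter m (sum_translate L) (F g).
Proof. by elim: m => //= m ->; exact: sum_translate_sum. Qed.

Lemma rkn_eval f z : rkbounded K f -> `|f z| <= rkn f * Num.sqrt (K z z).
Proof.
move=> fb; have := ev_le_rknorm2 [:: (1, z)] fb.
rewrite gram1 /ev big_seq1 mul1r => h.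
by rewrite -sqrtr_sqr -sqrtrM ?rknorm2_ge0// ler_wsqrtr.
Qed.

End Contraction.

(** * The Green form of a coboundary *)

Section GreenForm.
Context {R : realType} {G : topologicalGroupType} {V : lmodType R}.
Variables (b : semi_inner V) (pi : G -> V -> V).
Hypothesis pi_linear : forall g, linear (pi g).
Hypothesis pi1 : forall x, pi 1%g x = x.
Hypothesis piM : forall g h x, pi (g * h)%g x = pi g (pi h x).
Hypothesis pi_ip : forall g x y, b (pi g x) (pi g y) = b x y.
Variables (L : seq G) (r0 r : R).
Notation K := (hs_kernel b pi).
Notation act := (hs_act pi).
Hypothesis r0_ge0 : 0 <= r0.
Hypothesis contraction : forall f, rkbounded K f ->
  rkn K (sum_translate act L f) <= r0 * rkn K f.
Hypothesis r0_lt : r0 < r.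

(* The operator [<., x> x] as an element of the Hilbert-Schmidt space. *)
Definition rank_one (x : V) (z : (G * V) * (G * V)) : R :=
  ip2 b (cob2 pi z) (x, x).

(** Cauchy-Schwarz for the tensor form, applied to the pairing with [(x, x)]; it covers the [x]
    outside the span of the coboundaries. *)
Lemma rank_one_bounded x : rkbounded K (rank_one x) /\
  rknorm2 K (rank_one x) <= b x x ^+ 2.
Proof.
have le t : ev (rank_one x) t ^+ 2 <= b x x ^+ 2 * gram K t t.
  have ip2C p q : ip2 b p q = ip2 b q p by rewrite /ip2 (ipC b p.1) (ipC b p.2).
  pose K2 := Kernel ip2C (gram_ip2_ge0 b).
  have -> : ev (rank_one x) t = gram K2 (cobt pi t) [:: (1, (x, x))].
    rewrite /gram /cobt /ev big_map; apply: eq_bigr => p _ /=.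
    by rewrite big_seq1 mul1r.
  apply: (le_trans (gram_cauchy_schwarz K2 _ _)).
  by rewrite gram1 mulrC (gram_hs_fun b pi) /= /ip2 /= expr2.
by split; [exists (b x x ^+ 2)|apply: rknorm2_le => //; exact: sqr_ge0].
Qed.

Lemma translate_rank_one g x : translate act g (rank_one x) = rank_one (pi g x).
Proof.
apply/funext => z; rewrite /translate /rank_one /ip2 /cob2 /=.
rewrite !(coboundary_conj_act pi_linear piM).
have E y : b (pi g^-1%g y) x = b y (pi g x) by rewrite -(pi_ip g) -piM mulgV pi1.
by rewrite !E.
Qed.

Section Series.
Variable a : G * V.
Let e := coboundary pi a.

(* [\sum_m green_term m x / r ^ m] pairs the rank one operators of [x] and [e]
   through the Green operator of the sum of the translates over [L]. *)
Fixpoint green_term (m : nat) (x : V) : R :=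
  if m is m'.+1 then \sum_(g <- L) green_term m' (pi g x) else b e x ^+ 2.

Lemma green_term_iter m x :
  green_term m x = iter m (sum_translate act L) (rank_one x) (a, a).
Proof.
elim: m x => [|m IH] x; first by rewrite /= /rank_one /ip2 /= expr2.
rewrite iterSr [X in iter m _ X]/sum_translate.
under [X in iter m _ X]eq_bigr do rewrite translate_rank_one.
rewrite (iter_sum_translate_sum _ L m L (fun g => rank_one (pi g x))) /=.
under eq_bigr do rewrite IH.
have sumE (s : seq G) (F : G -> (G * V) * (G * V) -> R) z :
    (\sum_(g <- s) F g) z = \sum_(g <- s) F g z.
  by elim: s => [|g s IHs]; rewrite ?big_nil// !big_cons -IHs.
by rewrite sumE.
Qed.

Lemma green_term_ge0 m x : 0 <= green_term m x.
Proof.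
elim: m x => [|m IH] x /=; first exact: sqr_ge0.
by apply: sumr_ge0 => g _.
Qed.

(** The contraction bounds the norm of the iterate by [r0^m b x x], and evaluation at [(a, a)] costs
    a factor [b e e]. *)
Lemma green_term_le m x : green_term m x <= r0 ^+ m * (b e e * b x x).
Proof.
have [xb xn] := rank_one_bounded x.
rewrite green_term_iter (le_trans (ler_norm _))//.
have hb : rkbounded K (iter m (sum_translate act L) (rank_one x)).
  exact: (iter_sum_translate (hs_actK pi_linear piM pi_ip)).
apply: (le_trans (rkn_eval (a, a) hb)).
have kE : Num.sqrt (K (a, a) (a, a)) = b e e.
  by rewrite /= /hs_fun /ip2 /= -expr2 sqrtr_sqr ger0_norm ?ip_ge0.
rewrite kE (mulrC (b e e) (b x x)) mulrA ler_wpM2r ?ip_ge0//.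
have := iter_sum_translate_le (hs_actK pi_linear piM pi_ip) m r0_ge0 contraction xb.
move=> /le_trans; apply; rewrite ler_wpM2l ?exprn_ge0//.
by rewrite /rkn -[leRHS]ger0_norm ?ip_ge0// -sqrtr_sqr ler_wsqrtr.
Qed.

Lemma green_term_quadratic m : quadratic (green_term m).
Proof.
elim: m => [|m IH] x y /=; first by rewrite !ipE; ring.
rewrite !mulr_sumr -!big_split/=; apply: eq_bigr => g _.
by rewrite (pi_D pi_linear) (piB pi_linear).
Qed.

Let r_gt0 : 0 < r. Proof. exact: le_lt_trans r0_lt. Qed.

Definition green_partial (N : nat) (x : V) : R :=
  \sum_(m < N) green_term m x / r ^+ m.

Lemma green_partial_mono x : nondecreasing_seq (green_partial ^~ x).
Proof.
apply/nondecreasing_seqP => N; rewrite /green_partial big_ord_recr/= lerDl.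
by rewrite divr_ge0 ?green_term_ge0 ?exprn_ge0// ltW.
Qed.

Lemma green_partial_le N x :
  green_partial N x <= (1 - r0 / r)^-1 * b e e * b x x.
Proof.
have t1 : r0 / r < 1 by rewrite ltr_pdivrMr// mul1r.
have t0 : 0 <= r0 / r by rewrite divr_ge0// ltW.
have sum M : \sum_(m < M) (r0 / r) ^+ m * (1 - r0 / r) = 1 - (r0 / r) ^+ M.
  by elim: M => [|M IH]; rewrite ?big_ord0 ?subrr// big_ord_recr/= IH exprS; ring.
apply: (@le_trans _ _ (\sum_(m < N) (r0 / r) ^+ m * (b e e * b x x))).
  apply: ler_sum => m _; rewrite ler_pdivrMr ?exprn_gt0//.
  apply: le_trans (green_term_le m x) _.
  by rewrite mulrAC -exprMn divfK// gt_eqF.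
rewrite -mulr_suml -mulrA ler_wpM2r ?mulr_ge0 ?ip_ge0//.
rewrite -[leRHS]mul1r ler_pdivlMr ?subr_gt0// mulr_suml sum.
by rewrite lerBlDr lerDl exprn_ge0.
Qed.

Definition green_form (x : V) : R := lim (green_partial N x @[N --> \oo]).

Lemma green_partial_cvg x : green_partial N x @[N --> \oo] --> green_form x.
Proof.
apply: nondecreasing_is_cvgn; first exact: green_partial_mono.
by exists ((1 - r0 / r)^-1 * b e e * b x x) => _ [N _ <-]; exact: green_partial_le.
Qed.

Lemma green_partial_le_form N x : green_partial N x <= green_form x.
Proof.
apply: nondecreasing_cvgn_le; first exact: green_partial_mono.
by apply/cvg_ex; exists (green_form x); exact: green_partial_cvg.
Qed.

Lemma green_form_le x c : (forall N, green_partial N x <= c) -> green_form x <= c.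
Proof.
move=> h; apply: limr_le; last by apply: nearW.
by apply/cvg_ex; exists (green_form x); exact: green_partial_cvg.
Qed.

Lemma green_form_ge x : b e x ^+ 2 <= green_form x.
Proof.
apply: le_trans (green_partial_le_form 1 x).
by rewrite /green_partial big_ord_recr big_ord0/= add0r expr0 divr1.
Qed.

Lemma green_form_quadratic : quadratic green_form.
Proof.
move=> x y.
have h1 : green_partial N (x + y) + green_partial N (x - y) @[N --> \oo] -->
    green_form (x + y) + green_form (x - y).
  by apply: cvgD; exact: green_partial_cvg.
have h2 : 2 * green_partial N x + 2 * green_partial N y @[N --> \oo] -->
    2 * green_form x + 2 * green_form y.
  by apply: cvgD; apply: cvgMr; exact: green_partial_cvg.
have E : (fun N => green_partial N (x + y) + green_partial N (x - y)) =
    (fun N => 2 * green_partial N x + 2 * green_partial N y).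
  apply/funext => N; rewrite /green_partial !mulr_sumr -!big_split/=.
  by apply: eq_bigr => m _; rewrite -mulrDl green_term_quadratic mulrDl -!mulrA.
rewrite E in h1; rewrite -(cvg_lim _ h1)//; exact: cvg_lim h2.
Qed.

(** Summing over [L] shifts the series by one index: the result is [r] times the series without its
    nonnegative term of index 0. *)
Lemma green_form_superharmonic : superharmonic pi L r green_form.
Proof.
move=> x.
have h : (\sum_(g <- L) green_partial N (pi g x)) @[N --> \oo] -->
    \sum_(g <- L) green_form (pi g x).
  apply: (@cvg_sum_seq _ _ _ \oo _ L (fun g N => green_partial N (pi g x))
    (fun g => green_form (pi g x))) => g _; exact: green_partial_cvg.
rewrite -(cvg_lim _ h)//; apply: limr_le; first by apply/cvg_ex; eexists; exact: h.
exists 0%N => // N _ /=; rewrite -ler_pdivrMl//.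
apply: le_trans (green_partial_le_form N.+1 x).
rewrite /green_partial big_ord_recl /= expr0 divr1 ler_wpDl ?sqr_ge0//.
rewrite exchange_big/= mulr_sumr le_eqVlt; apply/orP; left; apply/eqP.
apply: eq_bigr => m _; rewrite -mulr_suml /bump /= add1n exprS invfM.
by rewrite mulrCA.
Qed.

End Series.
End GreenForm.

(** * The theorem *)

Section Kazhdan.
Context {R : realType} {G : topologicalGroupType} {V : lmodType R}.
Variables (b : semi_inner V) (pi : G -> V -> V).
Hypothesis pi_linear : forall g, linear (pi g).
Hypothesis pi1 : forall x, pi 1%g x = x.
Hypothesis piM : forall g h x, pi (g * h)%g x = pi g (pi h x).
Hypothesis pi_ip : forall g x y, b (pi g x) (pi g y) = b x y.
Hypothesis pi_uc : forall d : R, 0 < d ->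
  \forall g \near (1%g : G), forall x, b (pi g x - x) (pi g x - x) <= d * b x x.

Lemma ea_uniform_not_T (g : G) (x : V) : 0 < b (pi g x - x) (pi g x - x) ->
  extremely_amenable G -> ~ property_T R G.
Proof.
move=> gx ea GT.
have actK := hs_actK pi_linear piM pi_ip.
have act1 := hs_act1 pi1.
have actM := hs_actM piM.
have [c [L0 c0 gap]] := property_T_gap act1 actM actK
  (hs_translate_cont pi_linear pi1 piM pi_ip pi_uc)
  (hs_no_invariant pi_linear pi1 piM pi_ip pi_uc ea) GT.
have [r0 [r00 r0n contr]] := sum_translate_contraction act1 actM actK c0 gap.
pose L := symmetrize L0; pose n : R := (size L)%:R.
(* Above [r0] the Green series converges; below [n] the forms decrease strictly on average. *)
pose r := (r0 + n) / 2.
have rr0 : r0 < r by rewrite /r /n; lra.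
have rn : r < n by rewrite /r /n; lra.
have rp : 0 < r := le_lt_trans r00 rr0.
pose s := (Num.sqrt (b (pi g x - x) (pi g x - x)))^-1.
(* The unit vector of the argument is a normalized coboundary, whose translates are again
   coboundaries and so have Green forms. *)
pose a0 : G * V := (g, s *: x).
have e0E : coboundary pi a0 = s *: (pi g x - x).
  have piZ : pi g (s *: x) = s *: pi g x.
    have := pi_linear g s x 0.
    have -> : pi g 0 = 0 by rewrite -(subrr (0 : V)) (piB pi_linear) !subrr.
    by rewrite !addr0.
  by rewrite /coboundary /= piZ scalerBr.
have e01 : b (coboundary pi a0) (coboundary pi a0) = 1.
  rewrite e0E ipZl ipZr mulrA -expr2 exprVn sqr_sqrtr ?mulVf// ?gt_eqF//.
  exact: ltW.
pose q z := green_form b pi L r (conj_act pi z a0).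
have cobE z : coboundary pi (conj_act pi z a0) = pi z (coboundary pi a0).
  by rewrite coboundary_conj_act.
apply: (@superharmonic_not_ea R G V b pi pi_linear pi1 piM pi_ip pi_uc L _
  (symmetrize_inv L0) r rp rn (coboundary pi a0) e01 q ((1 - r0 / r)^-1)) => //.
- move=> z y; apply: le_trans (sqr_ge0 _) _.
  exact: (green_form_ge pi_linear pi1 piM pi_ip r00 contr rr0).
- move=> z; exact: (green_form_quadratic pi_linear pi1 piM pi_ip r00 contr rr0).
- move=> z; exact: (green_form_superharmonic pi_linear pi1 piM pi_ip r00 contr rr0).
- move=> z y; rewrite -cobE.
  exact: (green_form_ge pi_linear pi1 piM pi_ip r00 contr rr0).
- move=> z y; apply: (green_form_le pi_linear pi1 piM pi_ip r00 contr rr0) => N.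
  apply: le_trans (green_partial_le pi_linear pi1 piM pi_ip r00 contr rr0 _ _ _) _.
  by rewrite cobE pi_ip e01 mulr1.
Qed.

End Kazhdan.

(** * Complex Hilbert spaces as real ones *)

Section Realification.
Context {R : realType} (H : hilbertType R).

(** A separate name for the type, able to carry the real module structure beside the complex one.
    The real part of the inner product induces the same norm. *)
Definition realified : Type := H.

HB.instance Definition _ := GRing.Zmodule.on realified.

Definition real_scale (a : R) (x : realified) : realified := (a%:C%C *: (x : H)).

Lemma real_scaleA a c x : real_scale a (real_scale c x) = real_scale (a * c) x.
Proof. by rewrite /real_scale scalerA rmorphM. Qed.
Lemma real_scale1 : left_id 1 real_scale.
Proof. by move=> x; rewrite /real_scale rmorph1 scale1r. Qed.
Lemma real_scaleDr : right_distributive real_scale +%R.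
Proof. by move=> a x y; rewrite /real_scale scalerDr. Qed.
Lemma real_scaleDl x : {morph real_scale^~ x : a c / a + c}.
Proof. by move=> a c; rewrite /real_scale rmorphD scalerDl. Qed.

HB.instance Definition _ := GRing.Zmodule_isLmodule.Build R realified
  real_scaleA real_scale1 real_scaleDr real_scaleDl.

Definition real_inner (x y : realified) : R := complex.Re (inner (x : H) (y : H)).

Lemma real_innerC x y : real_inner x y = real_inner y x.
Proof.
rewrite /real_inner.
have -> : inner (x : H) (y : H) = ((inner (y : H) (x : H))^*)%C.
  by rewrite [LHS]hermC expr0 mul1r.
by case: (inner _ _).
Qed.

Lemma real_inner_linear a x y z :
  real_inner (a *: x + y) z = a * real_inner x z + real_inner y z.
Proof.
rewrite /real_inner.
have -> : inner ((a *: x + y : realified) : H) (z : H) =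
    a%:C%C * inner (x : H) (z : H) + inner (y : H) (z : H).
  by rewrite linearDl linearZl_LR.
by case: (inner x z) (inner y z) => p q [u v] /=; ring.
Qed.

Lemma real_innerE x : real_inner x x = complex.Re `|x : H| ^+ 2.
Proof.
rewrite /real_inner inner_norm.
have : 0 <= `|x : H| by exact: normr_ge0.
case: `|x : H| => p q; rewrite lecE /= => /andP[/eqP -> _].
by rewrite expr2 /=; ring.
Qed.

Lemma real_inner_ge0 x : 0 <= real_inner x x.
Proof. by rewrite real_innerE sqr_ge0. Qed.

Definition real_form : semi_inner realified :=
  SemiInner real_innerC real_inner_linear real_inner_ge0.

Lemma real_form_eq0 x : real_form x x = 0 -> x = 0.
Proof.
move=> /=; rewrite real_innerE => /eqP; rewrite sqrf_eq0 => /eqP h.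
apply/eqP; rewrite -(@normr_eq0 _ H).
have : 0 <= `|x : H| by exact: normr_ge0.
rewrite eq_complex lecE h /= => /andP[/eqP -> _].
by rewrite !eqxx.
Qed.

End Realification.

Theorem corollary6p5 (R : realType) (G : topologicalGroupType)
    (G_hausdorff : hausdorff_space G)
    (G_nontrivial : exists g : G, g <> 1%g)
    (G_ea : extremely_amenable G)
    (G_rep : exists (H : hilbertType R) (pi : G -> H -> H),
        uniformly_continuous_rep pi /\ injective pi) :
  ~ property_T R G.
Proof.
case: G_rep => H [pi [[[pi_u piM'] pi_c] pi_inj]].
pose b := real_form H.
have pi1 x : pi 1%g x = x.
  have [_ [pi' piK _] _] := pi_u 1%g.
  have := congr1 (fun f => f x) (piM' 1%g 1%g); rewrite mul1g /= => e.
  by rewrite -[in RHS](piK x) {2}e piK.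
have pi_linear g : linear (pi g : realified H -> realified H).
  by have [lin _ _] := pi_u g; move=> a x y; exact: lin.
have piM g h x : pi (g * h)%g x = pi g (pi h x) by rewrite piM'.
have pi_ip g x y : b (pi g x) (pi g y) = b x y.
  by have [_ _ iso] := pi_u g; rewrite /b /= /real_inner iso.
have b0 (x : H) : b x x = complex.Re `|x| ^+ 2 by exact: real_innerE.
have b_eq0 x : b x x = 0 -> x = 0 by exact: real_form_eq0.
clearbody b.
have nrm0 (x : H) : 0 <= complex.Re `|x|.
  by have := normr_ge0 x; rewrite lecE => /andP[].
have op g (x : H) : b (pi g x - x) (pi g x - x) <=
    op_norm (fun x => pi g x - pi 1%g x) ^+ 2 * b x x.
  have nrmE (y : H) : `|y| = (complex.Re `|y|)%:C%C.
    by rewrite RRe_real// ger0_real.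
  have le4 y : b (pi g y - y) (pi g y - y) <= 4 * b y y.
    have := quadratic_ip b (pi g y) y; rewrite /= pi_ip.
    by have := ip_ge0 b (pi g y + y); lra.
  have [x0|xN0] := eqVneq (b x x) 0.
    by have := le4 x; rewrite x0 !mulr0.
  pose S := [set complex.Re `|pi g x - pi 1%g x| | x in [set x : H | `|x| <= 1]].
  (* As [sup] is 0 on unbounded sets, [op_norm] controls the vectors only once this bound is known;
     it is 2 because [pi g] is an isometry. *)
  have Ssup : has_sup S.
    split; first by exists (complex.Re `|pi g 0 - pi 1%g 0|), 0 => //=; rewrite normr0.
    exists 2 => _ [y /= y1 <-]; rewrite pi1 -ler_sqr ?nnegrE// -b0.
    apply: le_trans (le4 y) _; rewrite b0.
    have N1 : complex.Re `|y| <= 1 by move: y1; rewrite lecE => /andP[].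
    by have := nrm0 y; nra.
  have Nx : 0 < complex.Re `|x|.
    by rewrite lt_def nrm0 andbT -sqrf_eq0 -b0.
  pose c := (complex.Re `|x|)^-1; pose y : H := c%:C%C *: x.
  have c0 : 0 < c by rewrite invr_gt0.
  have y1 : `|y| <= 1.
    by rewrite normrZ [in leLHS]nrmE ger0_norm ?ler0c ?(ltW c0)// -rmorphM mulVf ?gt_eqF.
  have := sup_upper_bound Ssup (ex_intro2 _ _ y y1 erefl).
  rewrite pi1 -/(op_norm (fun x => pi g x - pi 1%g x)).
  have -> : pi g y - y = c%:C%C *: (pi g x - x).
    have [lin _ _] := pi_u g; have := lin c%:C%C x 0; rewrite addr0 => ->.
    have -> : pi g 0 = 0.
      by have := lin 1 0 0; rewrite !scale1r addr0 => /(congr1 (fun v => v - pi g 0));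
        rewrite addrK subrr.
    by rewrite addr0 scalerBr.
  rewrite normrZ [in leLHS]nrmE ger0_norm ?ler0c ?(ltW c0)// -rmorphM /=.
  rewrite mulrC ler_pdivrMr// => h.
  by rewrite !b0 -exprMn ler_sqr ?nnegrE// (le_trans _ h).
have pi_uc (d : R) : 0 < d ->
    \forall g \near (1%g : G), forall x, b (pi g x - x) (pi g x - x) <= d * b x x.
  move=> d0; have sd0 : 0 < Num.sqrt d by rewrite sqrtr_gt0.
  have /cvgrPdist_lt /(_ _ sd0) := pi_c 1%g.
  apply: filterS => g; rewrite sub0r normrN => gd x.
  apply: le_trans (op g x) _; rewrite ler_wpM2r ?ip_ge0//.
  rewrite -[leRHS]sqr_sqrtr ?(ltW d0)// -[leLHS]real_normK ?num_real//.
  by rewrite ler_sqr ?nnegrE ?sqrtr_ge0// ltW.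
have [g g1] := G_nontrivial.
(* Faithfulness on a nontrivial group yields a nonzero coboundary. *)
have [x gx] : exists x, pi g x <> x.
  apply: contrapT => nx; apply: g1; apply: pi_inj; apply/funext => x.
  by rewrite pi1; apply: contrapT => h; apply: nx; exists x.
apply: (@ea_uniform_not_T R G (realified H) b pi pi_linear pi1 piM pi_ip pi_uc g x) => //.
rewrite lt_def ip_ge0 andbT; apply/eqP => /b_eq0 /eqP.
by rewrite subr_eq0 => /eqP.
Qed.
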